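(* The only non-developable ruled Ricci surface in $\mathbb{R}^3$ which may be parametrized with line of striction contained in a plane is the helicoid. That is, a non-developable ruled Ricci surface admits a parametrization whose line of striction is contained in a plane if and only if it is a piece of helicoid.
   Context: $I,J\subset\mathbb{R}$ are open intervals and all curves and maps are smooth; $\wedge$ is the cross product. Ruled surfaces are assumed non-cylindrical and parametrized as follows: a ruled surface $\Sigma$ is a surface parametrized by an immersion $X:I\times J\to\mathbb{R}^3$, $X(t,u)=\alpha(t)+u\beta(t)$, with $\alpha:I\to\mathbb{R}^3$ and $\beta:I\to\mathbb{S}^2$ satisfying $\|\beta(t)\|=\|\beta'(t)\|=1$ and $\langle\alpha'(t),\beta'(t)\rangle=0$ for all $t\in I$. The curve $\alpha$ (not assumed regular) is then called the line of striction. There is a unique function $\lambda:I\to\mathbb{R}$ with $\alpha'\wedge\beta=\lambda\beta'$, called the distribution parameter; $\Sigma$ is non-developable if $\lambda$ does not vanish identically. ''Parametrized with line of striction contained in a plane'' means that there is such a parametrization for which $\alpha(I)$ lies in an affine plane of $\mathbb{R}^3$. A ruled Ricci surface is a ruled surface in $\mathbb{R}^3$ whose induced metric satisfies the Ricci condition $K\Delta K - \|\nabla K\|^2 - 4K^3 = 0$, where $K$ is the Gauss curvature, $\nabla$ the gradient and $\Delta=\mathrm{div}\,\nabla$ the Laplace–Beltrami operator of the induced metric. A piece of helicoid is, up to a rigid motion (isometry) of $\mathbb{R}^3$, a surface parametrized by $(t,u)\mapsto(0,0,at+b)+u(\cos t,\sin t,0)$, $(t,u)\in I\times J$, for constants $a\neq0$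 and $b$. ''The helicoid'' is understood up to rigid motions, choice of $a$, and passing to pieces. *)

(* Defs.v *)
From Stdlib Require Import Reals.
From Coquelicot Require Import Coquelicot.

Open Scope R_scope.

Notation R3 := (R * R * R)%type.

Definition px (v : R3) : R := fst (fst v).
Definition py (v : R3) : R := snd (fst v).
Definition pz (v : R3) : R := snd v.

Definition dot (v w : R3) : R := px v * px w + py v * py w + pz v * pz w.

Definition cross (v w : R3) : R3 :=
  (py v * pz w - pz v * py w,
   pz v * px w - px v * pz w,
   px v * py w - py v * px w).

Definition vnorm (v : R3) : R := sqrt (dot v v).

Definition open_interval (I : R -> Prop) : Prop :=
  exists a b : Rbar, Rbar_lt a b /\
    forall t : R, I t <-> Rbar_lt a t /\ Rbar_lt t b.

(* All functions below are total; only their values on the stated domains,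
   which are open, are ever constrained. *)

Definition smooth_on (I : R -> Prop) (f : R -> R) : Prop :=
  forall (n : nat) (t : R), I t -> ex_derive_n f n t.

Definition smooth_curve (I : R -> Prop) (c : R -> R3) : Prop :=
  smooth_on I (fun t => px (c t)) /\
  smooth_on I (fun t => py (c t)) /\
  smooth_on I (fun t => pz (c t)).

Definition vderive (c : R -> R3) (t : R) : R3 :=
  (Derive (fun s => px (c s)) t,
   Derive (fun s => py (c s)) t,
   Derive (fun s => pz (c s)) t).

(* [ex_diff_n f n] : all partial derivatives of order at most [n] exist and are
   continuous. *)
Definition smooth2_on (D : R -> R -> Prop) (f : R -> R -> R) : Prop :=
  forall (n : nat) (s t : R), D s t -> ex_diff_n f n s t.

Definition smooth2_map (D : R -> R -> Prop) (X : R -> R -> R3) : Prop :=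
  smooth2_on D (fun s t => px (X s t)) /\
  smooth2_on D (fun s t => py (X s t)) /\
  smooth2_on D (fun s t => pz (X s t)).

Definition d1 (f : R -> R -> R) (s t : R) : R := Derive (fun x => f x t) s.
Definition d2 (f : R -> R -> R) (s t : R) : R := Derive (fun y => f s y) t.

Definition vd1 (X : R -> R -> R3) (s t : R) : R3 := vderive (fun x => X x t) s.
Definition vd2 (X : R -> R -> R3) (s t : R) : R3 := vderive (fun y => X s y) t.

(* A surface in space is given by a map on a planar domain; it is considered up
   to the relation [same_surface] below.  The regularity requirements are in
   [immersed]. *)
Record surface : Type := Surface {
  dom : R -> R -> Prop;
  pos : R -> R -> R3
}.

Definition immersed (S : surface) : Prop :=
  open (fun p : R * R => dom S (fst p) (snd p)) /\
  smooth2_map (dom S) (pos S) /\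
  forall s t, dom S s t ->
    forall x y : R,
      plus (scal x (vd1 (pos S) s t)) (scal y (vd2 (pos S) s t)) = (zero : R3) ->
      x = 0 /\ y = 0.

(* The map (p, q) is a smooth diffeomorphism of D onto D', with inverse
   (p', q'). *)
Definition diffeo (D D' : R -> R -> Prop) (p q : R -> R -> R) : Prop :=
  exists p' q' : R -> R -> R,
    smooth2_on D p /\ smooth2_on D q /\
    smooth2_on D' p' /\ smooth2_on D' q' /\
    (forall s t, D s t ->
       D' (p s t) (q s t) /\
       p' (p s t) (q s t) = s /\ q' (p s t) (q s t) = t) /\
    (forall s t, D' s t ->
       D (p' s t) (q' s t) /\
       p (p' s t) (q' s t) = s /\ q (p' s t) (q' s t) = t).

(* [T] is a reparametrization of [S]. *)
Definition same_surface (T S : surface) : Prop :=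
  exists p q : R -> R -> R,
    diffeo (dom T) (dom S) p q /\
    forall s t, dom T s t -> pos T s t = pos S (p s t) (q s t).

Section Geometry.
Variable S : surface.

Definition fE (s t : R) : R := dot (vd1 (pos S) s t) (vd1 (pos S) s t).
Definition fF (s t : R) : R := dot (vd1 (pos S) s t) (vd2 (pos S) s t).
Definition fG (s t : R) : R := dot (vd2 (pos S) s t) (vd2 (pos S) s t).
Definition detg (s t : R) : R := fE s t * fG s t - fF s t ^ 2.

Definition normal (s t : R) : R3 :=
  let n := cross (vd1 (pos S) s t) (vd2 (pos S) s t) in
  scal (/ vnorm n) n.

Definition fL (s t : R) : R := dot (vd1 (vd1 (pos S)) s t) (normal s t).
Definition fM (s t : R) : R := dot (vd2 (vd1 (pos S)) s t) (normal s t).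
Definition fN (s t : R) : R := dot (vd2 (vd2 (pos S)) s t) (normal s t).

Definition gauss_curvature (s t : R) : R :=
  (fL s t * fN s t - fM s t ^ 2) / detg s t.

(* Vector fields on the surface are given by their components in the
   coordinate frame. *)
Definition grad1 (f : R -> R -> R) (s t : R) : R :=
  (fG s t * d1 f s t - fF s t * d2 f s t) / detg s t.
Definition grad2 (f : R -> R -> R) (s t : R) : R :=
  (fE s t * d2 f s t - fF s t * d1 f s t) / detg s t.

Definition metric_norm2 (v w : R -> R -> R) (s t : R) : R :=
  fE s t * v s t ^ 2 + 2 * fF s t * v s t * w s t + fG s t * w s t ^ 2.

Definition divergence (v w : R -> R -> R) (s t : R) : R :=
  (d1 (fun x y => sqrt (detg x y) * v x y) s t +
   d2 (fun x y => sqrt (detg x y) * w x y) s t) / sqrt (detg s t).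

Definition laplacian (f : R -> R -> R) : R -> R -> R :=
  divergence (grad1 f) (grad2 f).

Definition ricci_condition : Prop :=
  forall s t, dom S s t ->
    let K := gauss_curvature in
    K s t * laplacian K s t - metric_norm2 (grad1 K) (grad2 K) s t
      - 4 * K s t ^ 3 = 0.

End Geometry.

Definition ruled_patch (I J : R -> Prop) (alpha beta : R -> R3) : surface :=
  Surface (fun t u => I t /\ J u)
          (fun t u => plus (alpha t) (scal u (beta t))).

Definition ruled_parametrization (S : surface)
    (I J : R -> Prop) (alpha beta : R -> R3) : Prop :=
  open_interval I /\ open_interval J /\
  smooth_curve I alpha /\ smooth_curve I beta /\
  (forall t, I t ->
     vnorm (beta t) = 1 /\ vnorm (vderive beta t) = 1 /\
     dot (vderive alpha t) (vderive beta t) = 0) /\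
  immersed (ruled_patch I J alpha beta) /\
  same_surface (ruled_patch I J alpha beta) S.

Definition ruled_surface (S : surface) : Prop :=
  exists (I J : R -> Prop) (alpha beta : R -> R3),
    ruled_parametrization S I J alpha beta.

Definition distribution_parameter (I : R -> Prop) (alpha beta : R -> R3)
    (lambda : R -> R) : Prop :=
  forall t, I t ->
    cross (vderive alpha t) (beta t) = scal (lambda t) (vderive beta t).

Definition non_developable (S : surface) : Prop :=
  exists (I J : R -> Prop) (alpha beta : R -> R3) (lambda : R -> R),
    ruled_parametrization S I J alpha beta /\
    distribution_parameter I alpha beta lambda /\
    ~ (forall t, I t -> lambda t = 0).

Definition ruled_ricci_surface (S : surface) : Prop :=
  ruled_surface S /\ ricci_condition S.

Definition in_affine_plane (A : R3 -> Prop) : Prop :=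
  exists (n : R3) (c : R), n <> zero /\ forall v, A v -> dot n v = c.

Definition planar_striction_parametrization (S : surface) : Prop :=
  exists (I J : R -> Prop) (alpha beta : R -> R3),
    ruled_parametrization S I J alpha beta /\
    in_affine_plane (fun v => exists t, I t /\ v = alpha t).

Definition isometry (m : R3 -> R3) : Prop :=
  forall v w : R3, vnorm (minus (m v) (m w)) = vnorm (minus v w).

Definition helicoid (a b : R) (t u : R) : R3 :=
  plus ((0, 0, a * t + b) : R3) (scal u ((cos t, sin t, 0) : R3)).

Definition helicoid_piece (S : surface) : Prop :=
  exists (I J : R -> Prop) (a b : R) (m : R3 -> R3),
    open_interval I /\ open_interval J /\ a <> 0 /\ isometry m /\
    same_surface
      (Surface (fun t u => I t /\ J u) (fun t u => m (helicoid a b t u))) S.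

(* Main.v *)
From Stdlib Require Import Reals Lra.
From Coquelicot Require Import Coquelicot.
(* Imported last: the reals also provide projections named [d1] and [d2]. *)
Require Import Defs.

(** Along a ruled patch [alpha + u beta] use the orthonormal frame [beta],
[beta'], [nu = beta ^ beta'], and write [alpha' = mu beta + lambda nu]; here
[lambda] is the distribution parameter.  The metric is
[E = lambda^2 + mu^2 + u^2], [F = mu], [G = 1], and the curvature is
[K = - lambda^2 / (lambda^2 + u^2)^2], so everything intrinsic depends on
[lambda] and [mu] only.

_Rigidity._  For fixed [t], the Ricci expression multiplied by
[(lambda^2 + u^2)^7] is a polynomial of degree four in [u] ([patch_ricci]).  It
vanishes on an interval, hence identically, and its coefficients force
[lambda' = 0] and [mu = 0] at every [t] with [lambda t <> 0]
([ricci_polynomial_rigid]).  Consequently [lambda lambda' = 0] at every [t],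
zeros of [lambda] included, so [lambda^2] is constant: as soon as [lambda] is
nonzero somewhere it is a nonzero constant, and [alpha' = lambda nu]
([distribution_constant]).

_Planarity._  What remains free is the geodesic curvature [kappa] of the
spherical curve [beta]: [beta'' = - beta + kappa nu] and [nu' = - kappa beta'].
If [alpha] stays in a plane with normal [n], differentiating
[n . alpha' = 0] gives [kappa (n . beta') = 0].  Differentiating once more at a
point where [kappa <> 0] shows that [n] is orthogonal to the whole frame, which
is absurd ([twist_eq0]).  So [kappa = 0], [beta] runs through a great circle at
unit speed, [alpha] runs through the axis of that circle at speed [lambda], and
the surface is a helicoid ([planar_striction_helicoid]).

_Converse._  An isometry of space is affine orthogonal
([isometry_frame_map]), so a piece of helicoid is a ruled patch whose line of
striction is its axis; it has [mu = 0] and [lambda^2] constant, and the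
polynomial above is then zero.

_Invariance._  The Ricci condition and non-developability are assumed for a
surface or for one of its parametrizations, but are used in another one.
Both are transported by showing that [K] and the Ricci expression are unchanged
by reparametrization ([same_surface_curvature], [same_surface_ricci]);
non-developability means that [K] does not vanish identically. *)

Local Open Scope R_scope.

(** * Smooth functions of two variables *)

Definition planar_open (D : R -> R -> Prop) : Prop :=
  open (fun p : R * R => D (fst p) (snd p)).

Lemma planar_open_near (D : R -> R -> Prop) (hD : planar_open D) (s t : R) :
  D s t -> locally_2d D s t.
Proof. intro h. apply locally_2d_locally. exact (hD (s, t) h). Qed.

Lemma planar_open_near1 (D : R -> R -> Prop) (hD : planar_open D) (s t : R) :
  D s t -> locally s (fun x => D x t).
Proof.
  intro h. exact (locally_2d_1d_const_y _ _ _ (planar_open_near D hD s t h)).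
Qed.

Lemma planar_open_near2 (D : R -> R -> Prop) (hD : planar_open D) (s t : R) :
  D s t -> locally t (fun y => D s y).
Proof.
  intro h. exact (locally_2d_1d_const_x _ _ _ (planar_open_near D hD s t h)).
Qed.

Definition agree (D : R -> R -> Prop) (f g : R -> R -> R) : Prop :=
  forall s t, D s t -> f s t = g s t.

Lemma d1_agree (D : R -> R -> Prop) (hD : planar_open D) (f g : R -> R -> R) :
  agree D f g -> agree D (d1 f) (d1 g).
Proof.
  intros h s t hst. apply Derive_ext_loc.
  apply (filter_imp (fun x => D x t)).
  - intros x hx. now apply h.
  - now apply planar_open_near1.
Qed.

Lemma d2_agree (D : R -> R -> Prop) (hD : planar_open D) (f g : R -> R -> R) :
  agree D f g -> agree D (d2 f) (d2 g).
Proof.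
  intros h s t hst. apply Derive_ext_loc.
  apply (filter_imp (fun y => D s y)).
  - intros y hy. now apply h.
  - now apply planar_open_near2.
Qed.

(** Closure properties have to be proved one order at a time: the derivative of a
product or of an inverse involves the functions themselves, to which the
induction hypothesis applies at the lower order only. *)
Definition diff_on (n : nat) (D : R -> R -> Prop) (f : R -> R -> R) : Prop :=
  forall s t, D s t -> ex_diff_n f n s t.

Lemma diff_on_agree n D (hD : planar_open D) f g :
  agree D f g -> diff_on n D f -> diff_on n D g.
Proof.
  intros h hf s t hst. apply (ex_diff_n_ext_loc f).
  - destruct (planar_open_near D hD s t hst) as [e he].
    exists e. intros u v hu hv. apply h. now apply he.
  - now apply hf.
Qed.

Lemma diff_on_le m n D f : (m <= n)%nat -> diff_on n D f -> diff_on m D f.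
Proof. intros h hf s t hst. apply (ex_diff_n_m n m h). now apply hf. Qed.

Lemma diff_on_cont n D f s t : diff_on n D f -> D s t -> continuity_2d_pt f s t.
Proof. intros hf hst. specialize (hf s t hst). destruct n; apply hf. Qed.

Lemma diff_on_ex1 n D f s t :
  diff_on (S n) D f -> D s t -> ex_derive (fun x => f x t) s.
Proof. intros hf hst. apply (hf s t hst). Qed.

Lemma diff_on_ex2 n D f s t :
  diff_on (S n) D f -> D s t -> ex_derive (fun y => f s y) t.
Proof. intros hf hst. apply (hf s t hst). Qed.

Lemma diff_on_d1 n D f : diff_on (S n) D f -> diff_on n D (d1 f).
Proof. intros hf s t hst. apply (hf s t hst). Qed.

Lemma diff_on_d2 n D f : diff_on (S n) D f -> diff_on n D (d2 f).
Proof. intros hf s t hst. apply (hf s t hst). Qed.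

(** The introduction rule that drives the inductions on the order below: once the
partial derivatives have been computed, their own regularity is a statement of
lower order. *)
Lemma diff_on_S n D f :
  (forall s t, D s t -> continuity_2d_pt f s t) ->
  (forall s t, D s t -> ex_derive (fun x => f x t) s) ->
  (forall s t, D s t -> ex_derive (fun y => f s y) t) ->
  diff_on n D (d1 f) -> diff_on n D (d2 f) -> diff_on (S n) D f.
Proof.
  intros hc h1 h2 h3 h4 s t hst. simpl. repeat split.
  - now apply hc.
  - now apply h1.
  - now apply h2.
  - now apply h3.
  - now apply h4.
Qed.

Lemma diff_on_const n D c : diff_on n D (fun _ _ => c).
Proof.
  revert c. induction n as [|n IH]; intros c.
  - intros s t _. split; [apply continuity_2d_pt_const | exact I].
  - apply diff_on_S.
    + intros; apply continuity_2d_pt_const.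
    + intros; apply @ex_derive_const.
    + intros; apply @ex_derive_const.
    + intros s t h. apply (ex_diff_n_ext_loc (fun _ _ => 0)).
      * apply locally_2d_forall. intros. unfold d1, d2. now rewrite Derive_const.
      * now apply IH.
    + intros s t h. apply (ex_diff_n_ext_loc (fun _ _ => 0)).
      * apply locally_2d_forall. intros. unfold d1, d2. now rewrite Derive_const.
      * now apply IH.
Qed.

Lemma diff_on_plus n D (hD : planar_open D) f g :
  diff_on n D f -> diff_on n D g -> diff_on n D (fun s t => f s t + g s t).
Proof.
  revert f g. induction n as [|n IH]; intros f g hf hg.
  - intros s t hst. split; [|exact I].
    apply continuity_2d_pt_plus; eapply diff_on_cont; eauto.
  - apply diff_on_S.
    + intros s t hst. apply continuity_2d_pt_plus; eapply diff_on_cont; eauto.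
    + intros s t hst. apply @ex_derive_plus; eapply diff_on_ex1; eauto.
    + intros s t hst. apply @ex_derive_plus; eapply diff_on_ex2; eauto.
    + apply (diff_on_agree n D hD (fun s t => d1 f s t + d1 g s t)).
      * intros s t hst. symmetry. unfold d1.
        apply Derive_plus; eapply diff_on_ex1; eauto.
      * apply IH; now apply diff_on_d1.
    + apply (diff_on_agree n D hD (fun s t => d2 f s t + d2 g s t)).
      * intros s t hst. symmetry. unfold d2.
        apply Derive_plus; eapply diff_on_ex2; eauto.
      * apply IH; now apply diff_on_d2.
Qed.

Lemma diff_on_mult n D (hD : planar_open D) f g :
  diff_on n D f -> diff_on n D g -> diff_on n D (fun s t => f s t * g s t).
Proof.
  revert f g. induction n as [|n IH]; intros f g hf hg.
  - intros s t hst. split; [|exact I].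
    apply continuity_2d_pt_mult; eapply diff_on_cont; eauto.
  - assert (hf' := diff_on_le n (S n) D f (Nat.le_succ_diag_r n) hf).
    assert (hg' := diff_on_le n (S n) D g (Nat.le_succ_diag_r n) hg).
    apply diff_on_S.
    + intros s t hst. apply continuity_2d_pt_mult; eapply diff_on_cont; eauto.
    + intros s t hst. apply ex_derive_mult; eapply diff_on_ex1; eauto.
    + intros s t hst. apply ex_derive_mult; eapply diff_on_ex2; eauto.
    + apply (diff_on_agree n D hD
               (fun s t => d1 f s t * g s t + f s t * d1 g s t)).
      * intros s t hst. symmetry. unfold d1.
        apply (Derive_mult (fun x => f x t) (fun x => g x t));
          eapply diff_on_ex1; eauto.
      * apply diff_on_plus; auto; apply IH; auto; now apply diff_on_d1.
    + apply (diff_on_agree n D hD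
               (fun s t => d2 f s t * g s t + f s t * d2 g s t)).
      * intros s t hst. symmetry. unfold d2.
        apply (Derive_mult (fun y => f s y) (fun y => g s y));
          eapply diff_on_ex2; eauto.
      * apply diff_on_plus; auto; apply IH; auto; now apply diff_on_d2.
Qed.

Lemma diff_on_inv n D (hD : planar_open D) f :
  (forall s t, D s t -> f s t <> 0) ->
  diff_on n D f -> diff_on n D (fun s t => / f s t).
Proof.
  intro h0. induction n as [|n IH]; intros hf.
  - intros s t hst. split; [|exact I].
    apply continuity_2d_pt_inv; auto. eapply diff_on_cont; eauto.
  - assert (hf' := diff_on_le n (S n) D f (Nat.le_succ_diag_r n) hf).
    apply diff_on_S.
    + intros s t hst. apply continuity_2d_pt_inv; auto. eapply diff_on_cont; eauto.
    + intros s t hst. apply (ex_derive_inv (fun x => f x t)); auto.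
      eapply diff_on_ex1; eauto.
    + intros s t hst. apply (ex_derive_inv (fun y => f s y)); auto.
      eapply diff_on_ex2; eauto.
    + apply (diff_on_agree n D hD
               (fun s t => (-1) * d1 f s t * (/ f s t * / f s t))).
      * intros s t hst. symmetry. unfold d1.
        rewrite (Derive_inv (fun x => f x t)); auto.
        -- field. auto.
        -- eapply diff_on_ex1; eauto.
      * apply diff_on_mult; auto; apply diff_on_mult; auto.
        -- apply diff_on_const.
        -- now apply diff_on_d1.
    + apply (diff_on_agree n D hD
               (fun s t => (-1) * d2 f s t * (/ f s t * / f s t))).
      * intros s t hst. symmetry. unfold d2.
        rewrite (Derive_inv (fun y => f s y)); auto.
        -- field. auto.
        -- eapply diff_on_ex2; eauto.
      * apply diff_on_mult; auto; apply diff_on_mult; auto.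
        -- apply diff_on_const.
        -- now apply diff_on_d2.
Qed.

Section Smooth.
Variable D : R -> R -> Prop.
Hypothesis hD : planar_open D.

Lemma smooth2_cont f s t : smooth2_on D f -> D s t -> continuity_2d_pt f s t.
Proof. intros hf. exact (diff_on_cont 0 D f s t (hf 0%nat)). Qed.

Lemma smooth2_ex1 f s t : smooth2_on D f -> D s t -> ex_derive (fun x => f x t) s.
Proof. intros hf. exact (diff_on_ex1 0 D f s t (hf 1%nat)). Qed.

Lemma smooth2_ex2 f s t : smooth2_on D f -> D s t -> ex_derive (fun y => f s y) t.
Proof. intros hf. exact (diff_on_ex2 0 D f s t (hf 1%nat)). Qed.

Lemma smooth2_d1 f : smooth2_on D f -> smooth2_on D (d1 f).
Proof. intros hf n. exact (diff_on_d1 n D f (hf (S n))). Qed.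

Lemma smooth2_d2 f : smooth2_on D f -> smooth2_on D (d2 f).
Proof. intros hf n. exact (diff_on_d2 n D f (hf (S n))). Qed.

Lemma smooth2_agree f g : agree D f g -> smooth2_on D f -> smooth2_on D g.
Proof. intros h hf n. exact (diff_on_agree n D hD f g h (hf n)). Qed.

Lemma smooth2_const c : smooth2_on D (fun _ _ => c).
Proof. intro n. exact (diff_on_const n D c). Qed.

Lemma smooth2_snd : smooth2_on D (fun _ t => t).
Proof.
  intros [|n].
  - intros s t _. split; [apply continuity_2d_pt_id2 | exact I].
  - apply diff_on_S.
    + intros; apply continuity_2d_pt_id2.
    + intros; apply @ex_derive_const.
    + intros; apply ex_derive_id.
    + apply (diff_on_agree n D hD (fun _ _ => 0)).
      * intros s t _. unfold d1. now rewrite Derive_const.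
      * apply diff_on_const.
    + apply (diff_on_agree n D hD (fun _ _ => 1)).
      * intros s t _. unfold d2. now rewrite Derive_id.
      * apply diff_on_const.
Qed.

Lemma smooth2_plus f g :
  smooth2_on D f -> smooth2_on D g -> smooth2_on D (fun s t => f s t + g s t).
Proof. intros hf hg n. exact (diff_on_plus n D hD f g (hf n) (hg n)). Qed.

Lemma smooth2_mult f g :
  smooth2_on D f -> smooth2_on D g -> smooth2_on D (fun s t => f s t * g s t).
Proof. intros hf hg n. exact (diff_on_mult n D hD f g (hf n) (hg n)). Qed.

Lemma smooth2_inv f :
  (forall s t, D s t -> f s t <> 0) ->
  smooth2_on D f -> smooth2_on D (fun s t => / f s t).
Proof. intros h0 hf n. exact (diff_on_inv n D hD f h0 (hf n)). Qed.

Lemma smooth2_opp f : smooth2_on D f -> smooth2_on D (fun s t => - f s t).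
Proof.
  intro hf. apply (smooth2_agree (fun s t => (-1) * f s t)).
  - intros s t _. ring.
  - apply smooth2_mult; auto. apply smooth2_const.
Qed.

Lemma smooth2_minus f g :
  smooth2_on D f -> smooth2_on D g -> smooth2_on D (fun s t => f s t - g s t).
Proof.
  intros hf hg. apply (smooth2_plus f (fun s t => - g s t)); auto.
  now apply smooth2_opp.
Qed.

Lemma smooth2_div f g :
  (forall s t, D s t -> g s t <> 0) ->
  smooth2_on D f -> smooth2_on D g -> smooth2_on D (fun s t => f s t / g s t).
Proof.
  intros h0 hf hg. apply (smooth2_mult f (fun s t => / g s t)); auto.
  now apply smooth2_inv.
Qed.

Lemma smooth2_pow f k : smooth2_on D f -> smooth2_on D (fun s t => f s t ^ k).
Proof.
  intro hf. induction k as [|k IH].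
  - exact (smooth2_const 1).
  - now apply (smooth2_mult f (fun s t => f s t ^ k)).
Qed.

Lemma smooth2_schwarz f s t :
  smooth2_on D f -> D s t -> d1 (d2 f) s t = d2 (d1 f) s t.
Proof.
  intros hf hst. apply Schwarz.
  - destruct (planar_open_near D hD s t hst) as [e he].
    exists e. intros u v hu hv. specialize (he u v hu hv). repeat split.
    + now apply smooth2_ex1.
    + now apply smooth2_ex2.
    + now apply (smooth2_ex1 (d2 f)); [apply smooth2_d2|].
    + now apply (smooth2_ex2 (d1 f)); [apply smooth2_d1|].
  - apply (smooth2_cont (d1 (d2 f))); auto. now apply smooth2_d1, smooth2_d2.
  - apply (smooth2_cont (d2 (d1 f))); auto. now apply smooth2_d2, smooth2_d1.
Qed.

(** Continuity of one partial derivative upgrades the existence of both to total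
differentiability, which is what the chain rule needs. *)
Lemma smooth2_differentiable f s t :
  smooth2_on D f -> D s t -> differentiable_pt_lim f s t (d1 f s t) (d2 f s t).
Proof.
  intros hf hst. apply filterdiff_differentiable_pt_lim.
  apply is_derive_filterdiff.
  - destruct (proj1 (locally_2d_locally _ _ _) (planar_open_near D hD s t hst)) as [e he].
    exists e. intros [u v] huv. simpl. apply Derive_correct.
    apply smooth2_ex1; auto. exact (he _ huv).
  - apply Derive_correct. now apply smooth2_ex2.
  - apply continuity_2d_pt_filterlim. apply smooth2_cont; auto.
    now apply smooth2_d1.
Qed.
End Smooth.

Lemma d1_plus D f g s t :
  smooth2_on D f -> smooth2_on D g -> D s t ->
  d1 (fun x y => f x y + g x y) s t = d1 f s t + d1 g s t.
Proof.
  intros hf hg hst. apply Derive_plus; now apply (smooth2_ex1 D).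
Qed.

Lemma d2_plus D f g s t :
  smooth2_on D f -> smooth2_on D g -> D s t ->
  d2 (fun x y => f x y + g x y) s t = d2 f s t + d2 g s t.
Proof.
  intros hf hg hst. apply Derive_plus; now apply (smooth2_ex2 D).
Qed.

Lemma d1_minus D f g s t :
  smooth2_on D f -> smooth2_on D g -> D s t ->
  d1 (fun x y => f x y - g x y) s t = d1 f s t - d1 g s t.
Proof.
  intros hf hg hst. apply Derive_minus; now apply (smooth2_ex1 D).
Qed.

Lemma d2_minus D f g s t :
  smooth2_on D f -> smooth2_on D g -> D s t ->
  d2 (fun x y => f x y - g x y) s t = d2 f s t - d2 g s t.
Proof.
  intros hf hg hst. apply Derive_minus; now apply (smooth2_ex2 D).
Qed.

Lemma d1_mult D f g s t :
  smooth2_on D f -> smooth2_on D g -> D s t ->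
  d1 (fun x y => f x y * g x y) s t = d1 f s t * g s t + f s t * d1 g s t.
Proof.
  intros hf hg hst.
  apply (Derive_mult (fun x => f x t) (fun x => g x t));
    now apply (smooth2_ex1 D).
Qed.

Lemma d2_mult D f g s t :
  smooth2_on D f -> smooth2_on D g -> D s t ->
  d2 (fun x y => f x y * g x y) s t = d2 f s t * g s t + f s t * d2 g s t.
Proof.
  intros hf hg hst.
  apply (Derive_mult (fun y => f s y) (fun y => g s y));
    now apply (smooth2_ex2 D).
Qed.

Section Composition.
Variables D D' : R -> R -> Prop.
Hypothesis hD : planar_open D.
Hypothesis hD' : planar_open D'.
Variables p q : R -> R -> R.
Hypothesis hp : smooth2_on D p.
Hypothesis hq : smooth2_on D q.
Hypothesis hpq : forall s t, D s t -> D' (p s t) (q s t).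

Lemma chain_differentiable f s t :
  smooth2_on D' f -> D s t ->
  differentiable_pt_lim (fun x y => f (p x y) (q x y)) s t
    (d1 f (p s t) (q s t) * d1 p s t + d2 f (p s t) (q s t) * d1 q s t)
    (d1 f (p s t) (q s t) * d2 p s t + d2 f (p s t) (q s t) * d2 q s t).
Proof.
  intros hf hst. apply differentiable_pt_lim_comp.
  - apply (smooth2_differentiable D'); auto.
  - now apply (smooth2_differentiable D).
  - now apply (smooth2_differentiable D).
Qed.

Lemma d1_comp f s t :
  smooth2_on D' f -> D s t ->
  d1 (fun x y => f (p x y) (q x y)) s t =
  d1 f (p s t) (q s t) * d1 p s t + d2 f (p s t) (q s t) * d1 q s t.
Proof.
  intros hf hst.
  apply (differentiable_pt_lim_unique _ _ _ _ _ (chain_differentiable f s t hf hst)).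
Qed.

Lemma d2_comp f s t :
  smooth2_on D' f -> D s t ->
  d2 (fun x y => f (p x y) (q x y)) s t =
  d1 f (p s t) (q s t) * d2 p s t + d2 f (p s t) (q s t) * d2 q s t.
Proof.
  intros hf hst.
  apply (differentiable_pt_lim_unique _ _ _ _ _ (chain_differentiable f s t hf hst)).
Qed.

Lemma comp_cont f s t :
  smooth2_on D' f -> D s t -> continuity_2d_pt (fun x y => f (p x y) (q x y)) s t.
Proof.
  intros hf hst. apply differentiable_continuity_pt.
  eexists; eexists. now apply chain_differentiable.
Qed.

(** By the chain rule the partial derivatives of [f (p, q)] are sums of products of
partial derivatives of [p] and [q] with compositions of the same kind, so
induction on the order applies to all smooth [f] at once. *)
Lemma smooth2_comp f :
  smooth2_on D' f -> smooth2_on D (fun x y => f (p x y) (q x y)).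
Proof.
  intros hf n. revert f hf. induction n as [|n IH]; intros f hf.
  - intros s t hst. split; [|exact I]. now apply comp_cont.
  - apply diff_on_S.
    + intros s t hst. now apply comp_cont.
    + intros s t hst. eexists. apply is_derive_Reals.
      apply (derivable_pt_lim_comp_2d f (fun x => p x t) (fun x => q x t)).
      * apply (smooth2_differentiable D'); auto.
      * apply is_derive_Reals, Derive_correct. now apply (smooth2_ex1 D).
      * apply is_derive_Reals, Derive_correct. now apply (smooth2_ex1 D).
    + intros s t hst. eexists. apply is_derive_Reals.
      apply (derivable_pt_lim_comp_2d f (fun y => p s y) (fun y => q s y)).
      * apply (smooth2_differentiable D'); auto.
      * apply is_derive_Reals, Derive_correct. now apply (smooth2_ex2 D).
      * apply is_derive_Reals, Derive_correct. now apply (smooth2_ex2 D).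
    + apply (diff_on_agree n D hD (fun s t => d1 f (p s t) (q s t) * d1 p s t
                                   + d2 f (p s t) (q s t) * d1 q s t)).
      * intros s t hst. symmetry. now apply d1_comp.
      * apply diff_on_plus; auto; apply diff_on_mult; auto.
        -- exact (IH (d1 f) (smooth2_d1 D' f hf)).
        -- exact (diff_on_d1 n D p (hp (S n))).
        -- exact (IH (d2 f) (smooth2_d2 D' f hf)).
        -- exact (diff_on_d1 n D q (hq (S n))).
    + apply (diff_on_agree n D hD (fun s t => d1 f (p s t) (q s t) * d2 p s t
                                   + d2 f (p s t) (q s t) * d2 q s t)).
      * intros s t hst. symmetry. now apply d2_comp.
      * apply diff_on_plus; auto; apply diff_on_mult; auto.
        -- exact (IH (d1 f) (smooth2_d1 D' f hf)).
        -- exact (diff_on_d2 n D p (hp (S n))).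
        -- exact (IH (d2 f) (smooth2_d2 D' f hf)).
        -- exact (diff_on_d2 n D q (hq (S n))).
Qed.
End Composition.

Ltac smooth2 hD :=
  repeat first
    [ assumption
    | apply (smooth2_const _ _)
    | apply (smooth2_plus _ hD)
    | apply (smooth2_minus _ hD)
    | apply (smooth2_opp _ hD)
    | apply (smooth2_mult _ hD)
    | apply (smooth2_pow _ hD)
    | apply (smooth2_d1 _)
    | apply (smooth2_d2 _) ].

(** * Vector algebra and isometries of space *)

Lemma scal_R3 c (v : R3) : scal c v = (c * px v, c * py v, c * pz v).
Proof. reflexivity. Qed.

Lemma plus_R3 (v w : R3) : plus v w = (px v + px w, py v + py w, pz v + pz w).
Proof. reflexivity. Qed.

Lemma minus_R3 (v w : R3) : minus v w = (px v - px w, py v - py w, pz v - pz w).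
Proof. reflexivity. Qed.

Lemma R3_eq (v w : R3) : px v = px w -> py v = py w -> pz v = pz w -> v = w.
Proof.
  destruct v as [[v1 v2] v3], w as [[w1 w2] w3]. unfold px, py, pz; simpl.
  now intros -> -> ->.
Qed.

Ltac coords :=
  repeat match goal with
    |- context [@zero ?V] => change (@zero V) with ((0, 0, 0) : R3)
  end;
  rewrite ?plus_R3, ?minus_R3, ?scal_R3;
  unfold dot, cross; unfold px, py, pz; cbn [fst snd].

Lemma dot_cross_self v w :
  dot (cross v w) (cross v w) = dot v v * dot w w - dot v w ^ 2.
Proof.
  destruct v as [[v1 v2] v3], w as [[w1 w2] w3].
  unfold dot, cross, px, py, pz; simpl. ring.
Qed.

Lemma dot_self_ge0 v : 0 <= dot v v.
Proof. unfold dot. nra. Qed.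

Lemma dot_self_eq0 v : dot v v = 0 -> v = zero.
Proof.
  destruct v as [[v1 v2] v3]. unfold dot, px, py, pz; simpl. intro h.
  assert (v1 = 0) by nra. assert (v2 = 0) by nra. assert (v3 = 0) by nra.
  now subst.
Qed.

Lemma dot_scal_r v w c : dot v (scal c w) = c * dot v w.
Proof.
  coords. ring.
Qed.

Lemma dot_comm v w : dot v w = dot w v.
Proof. unfold dot. ring. Qed.

Lemma vnorm_1 v : vnorm v = 1 -> dot v v = 1.
Proof.
  unfold vnorm. intro h. rewrite <- (sqrt_sqrt (dot v v)) by apply dot_self_ge0.
  rewrite h. ring.
Qed.

Lemma dot_zero_l v : dot zero v = 0.
Proof. coords. ring. Qed.

Lemma cross_cross u v w :
  cross (cross u v) w = minus (scal (dot u w) v) (scal (dot v w) u).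
Proof. apply R3_eq; coords; ring. Qed.

(** The double cross product [v ^ (x ^ v)] is the component of [x] orthogonal to
the unit vector [v]. *)
Lemma parallel_unit x v :
  cross x v = zero -> dot v v = 1 -> x = scal (dot x v) v.
Proof.
  intros h0 h1.
  assert (h : cross v (cross x v) = minus (scal (dot v v) x) (scal (dot x v) v)).
  { apply R3_eq; coords; ring. }
  rewrite h0, h1 in h.
  apply (f_equal (fun y => plus y (scal (dot x v) v))) in h.
  etransitivity; [|etransitivity; [symmetry; exact h|]];
    apply R3_eq; coords; ring.
Qed.

(** Both hypotheses of orthogonality enter through the expansion of
[(v ^ b) ^ b'].  Applied to [v = alpha'], this is the existence of the
distribution parameter. *)
Lemma cross_along v b b' :
  dot v b' = 0 -> dot b b' = 0 -> dot b' b' = 1 ->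
  cross v b = scal (dot (cross v b) b') b'.
Proof.
  intros h1 h2 h3. apply parallel_unit; [|exact h3].
  rewrite cross_cross, h1, h2. apply R3_eq; coords; ring.
Qed.

(** What is left of [x] after removing its components along [b] and [b'] is
orthogonal to both, hence parallel to [b ^ b']. *)
Lemma frame_expansion x b b' :
  dot b b = 1 -> dot b' b' = 1 -> dot b b' = 0 ->
  x = plus (plus (scal (dot x b) b) (scal (dot x b') b'))
           (scal (dot x (cross b b')) (cross b b')).
Proof.
  intros h1 h2 h3.
  set (y := minus x (plus (scal (dot x b) b) (scal (dot x b') b'))).
  assert (hn : dot (cross b b') (cross b b') = 1).
  { rewrite dot_cross_self, h1, h2, h3. ring. }
  assert (e1 : dot y b = 0).
  { transitivity (dot x b - (dot x b * dot b b + dot x b' * dot b b')).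
    - unfold y. coords. ring.
    - rewrite h1, h3. ring. }
  assert (e2 : dot y b' = 0).
  { transitivity (dot x b' - (dot x b * dot b b' + dot x b' * dot b' b')).
    - unfold y. coords. ring.
    - rewrite h2, h3. ring. }
  assert (e3 : cross y (cross b b') = zero).
  { transitivity (minus (scal (dot y b') b) (scal (dot y b) b')).
    - apply R3_eq; coords; ring.
    - rewrite e1, e2. apply R3_eq; coords; ring. }
  assert (e4 : dot y (cross b b') = dot x (cross b b')).
  { unfold y. coords. ring. }
  assert (e5 := parallel_unit y (cross b b') e3 hn). rewrite e4 in e5.
  rewrite <- e5. unfold y. apply R3_eq; coords; ring.
Qed.

(** The affine map that sends the standard frame at the origin to the frame
[(e1, e2, e3)] at [o]. *)
Definition frame_map (o e1 e2 e3 x : R3) : R3 :=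
  plus (plus (plus o (scal (px x) e1)) (scal (py x) e2)) (scal (pz x) e3).

Definition orthonormal (e1 e2 e3 : R3) : Prop :=
  dot e1 e1 = 1 /\ dot e2 e2 = 1 /\ dot e3 e3 = 1 /\
  dot e1 e2 = 0 /\ dot e1 e3 = 0 /\ dot e2 e3 = 0.

Lemma frame_map_isometry o e1 e2 e3 :
  orthonormal e1 e2 e3 -> isometry (frame_map o e1 e2 e3).
Proof.
  intros (h1 & h2 & h3 & h4 & h5 & h6) v w. unfold vnorm. f_equal.
  set (z := minus v w).
  transitivity (px z ^ 2 * dot e1 e1 + py z ^ 2 * dot e2 e2 + pz z ^ 2 * dot e3 e3
    + 2 * px z * py z * dot e1 e2 + 2 * px z * pz z * dot e1 e3
    + 2 * py z * pz z * dot e2 e3).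
  - unfold z, frame_map. coords. ring.
  - rewrite h1, h2, h3, h4, h5, h6. unfold dot. ring.
Qed.

(** Polarization: preserving distances to a fixed point and between points makes
[A v = m v - m 0] preserve scalar products.  The images of the standard basis
are then orthonormal, and [A x] minus its candidate expansion has norm zero. *)
Lemma isometry_frame_map m : isometry m ->
  exists o e1 e2 e3, orthonormal e1 e2 e3 /\ forall x, m x = frame_map o e1 e2 e3 x.
Proof.
  intro hm.
  assert (hm2 : forall v w, dot (minus (m v) (m w)) (minus (m v) (m w))
                            = dot (minus v w) (minus v w)).
  { intros v w.
    rewrite <- (sqrt_sqrt (dot (minus v w) (minus v w))) by apply dot_self_ge0.
    rewrite <- (sqrt_sqrt (dot (minus (m v) (m w)) _)) by apply dot_self_ge0.
    specialize (hm v w). unfold vnorm in hm. now rewrite hm. }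
  clear hm. set (O3 := (0, 0, 0) : R3).
  set (A := fun v => minus (m v) (m O3)).
  assert (hA : forall v w, dot (A v) (A w) = dot v w).
  { intros v w. assert (k1 := hm2 v O3). assert (k2 := hm2 w O3).
    assert (k3 := hm2 v w).
    assert (e : dot (minus (m v) (m w)) (minus (m v) (m w))
                = dot (A v) (A v) + dot (A w) (A w) - 2 * dot (A v) (A w)).
    { unfold A. coords. ring. }
    assert (e' : dot (minus v w) (minus v w) =
       dot (minus v O3) (minus v O3) + dot (minus w O3) (minus w O3)
       - 2 * dot v w).
    { unfold O3. coords. ring. }
    fold (A v) in k1. fold (A w) in k2. lra. }
  exists (m O3), (A (1, 0, 0)), (A (0, 1, 0)), (A (0, 0, 1)). split.
  - repeat split; rewrite hA; coords; ring.
  - intro x. set (e1 := (1, 0, 0) : R3). set (e2 := (0, 1, 0) : R3).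
    set (e3 := (0, 0, 1) : R3).
    set (y := minus (A x) (plus (plus (scal (px x) (A e1)) (scal (py x) (A e2)))
                                (scal (pz x) (A e3)))).
    assert (hy : dot y y = 0).
    { transitivity (dot (A x) (A x)
        - 2 * (px x * dot (A x) (A e1) + py x * dot (A x) (A e2)
               + pz x * dot (A x) (A e3))
        + (px x ^ 2 * dot (A e1) (A e1) + py x ^ 2 * dot (A e2) (A e2)
           + pz x ^ 2 * dot (A e3) (A e3)
           + 2 * px x * py x * dot (A e1) (A e2) + 2 * px x * pz x * dot (A e1) (A e3)
           + 2 * py x * pz x * dot (A e2) (A e3))).
      - unfold y. generalize (A x), (A e1), (A e2), (A e3). intros. coords. ring.
      - rewrite !hA. unfold e1, e2, e3. coords. ring. }
    apply dot_self_eq0 in hy. unfold y in hy.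
    assert (ex : A x = plus (plus (scal (px x) (A e1)) (scal (py x) (A e2)))
                                (scal (pz x) (A e3))).
    { apply (f_equal (fun z => plus z
        (plus (plus (scal (px x) (A e1)) (scal (py x) (A e2)))
              (scal (pz x) (A e3))))) in hy.
      etransitivity; [|etransitivity; [exact hy|]].
      - generalize (A x), (A e1), (A e2), (A e3). intros. apply R3_eq; coords; ring.
      - generalize (A e1), (A e2), (A e3). intros. apply R3_eq; coords; ring. }
    transitivity (plus (m O3) (A x)).
    + unfold A. apply R3_eq; coords; ring.
    + rewrite ex. unfold frame_map. generalize (A e1), (A e2), (A e3). intros.
      apply R3_eq; coords; ring.
Qed.

(** * Curvature, gradient and divergence in rational form *)

Section VectorFields.
Variable D : R -> R -> Prop.
Hypothesis hD : planar_open D.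

Lemma smooth2_vd1 V : smooth2_map D V -> smooth2_map D (vd1 V).
Proof. intros (h1 & h2 & h3). split; [|split]; now apply smooth2_d1 in h1, h2, h3. Qed.

Lemma smooth2_vd2 V : smooth2_map D V -> smooth2_map D (vd2 V).
Proof. intros (h1 & h2 & h3). split; [|split]; now apply smooth2_d2 in h1, h2, h3. Qed.

Lemma smooth2_dot V W :
  smooth2_map D V -> smooth2_map D W ->
  smooth2_on D (fun s t => dot (V s t) (W s t)).
Proof.
  intros (h1 & h2 & h3) (k1 & k2 & k3). unfold dot. smooth2 hD.
Qed.

Lemma smooth2_cross V W :
  smooth2_map D V -> smooth2_map D W ->
  smooth2_map D (fun s t => cross (V s t) (W s t)).
Proof.
  intros (h1 & h2 & h3) (k1 & k2 & k3).
  unfold cross. split; [|split];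
    unfold px, py, pz in *; simpl; smooth2 hD.
Qed.
End VectorFields.

Lemma Derive_sqrt_mult (h k : R -> R) x :
  ex_derive h x -> ex_derive k x -> 0 < h x ->
  Derive (fun y => sqrt (h y) * k y) x =
  sqrt (h x) * Derive k x + k x * Derive h x / (2 * sqrt (h x)).
Proof.
  intros hh hk h0. apply is_derive_unique. auto_derive; [auto|].
  assert (hp := sqrt_lt_R0 _ h0).
  change (fun y => h y) with h. change (fun y => k y) with k. field. lra.
Qed.

Section Curvature.
Variable S : surface.
Hypothesis hS : immersed S.

Lemma dom_open : planar_open (dom S).
Proof. apply hS. Qed.

Lemma pos_smooth : smooth2_map (dom S) (pos S).
Proof. apply hS. Qed.

(** Write [X1], [X2] for the coordinate vectors.  If [EG - F^2 = 0] then
[G X1 - F X2] has squared norm [G (EG - F^2) = 0], so independence gives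
[G = 0], that is [X2 = 0], a contradiction. *)
Lemma detg_pos s t : dom S s t -> 0 < detg S s t.
Proof.
  intro hst.
  assert (h0 : 0 <= detg S s t).
  { unfold detg, fE, fF, fG. rewrite <- dot_cross_self. apply dot_self_ge0. }
  destruct h0 as [h0 | h0]; [exact h0 | exfalso].
  destruct hS as (_ & _ & hi). specialize (hi s t hst).
  unfold detg, fE, fF, fG in h0.
  set (v := vd1 (pos S) s t) in *. set (w := vd2 (pos S) s t) in *.
  destruct (hi (dot w w) (- dot v w)) as [hw hvw].
  { apply dot_self_eq0.
    transitivity (dot w w * (dot v v * dot w w - dot v w ^ 2)).
    - coords. ring.
    - rewrite <- h0. ring. }
  destruct (hi 0 1) as [_ h1].
  { rewrite (dot_self_eq0 w hw). apply R3_eq; coords; ring. }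
  lra.
Qed.

(** The second fundamental form computed with the unnormalized normal [X1 ^ X2].
Its determinant is [EG - F^2] times [LN - M^2], so that the curvature becomes a
rational expression in derivatives of the position, visibly smooth. *)
Definition curvature_form (s t : R) : R :=
  let n := cross (vd1 (pos S) s t) (vd2 (pos S) s t) in
  dot (vd1 (vd1 (pos S)) s t) n * dot (vd2 (vd2 (pos S)) s t) n
  - dot (vd2 (vd1 (pos S)) s t) n ^ 2.

Lemma gauss_curvature_eq s t :
  dom S s t -> gauss_curvature S s t = curvature_form s t / detg S s t ^ 2.
Proof.
  intro hst. assert (hd := detg_pos s t hst).
  unfold gauss_curvature, fL, fM, fN, normal. cbv zeta.
  rewrite !dot_scal_r. unfold curvature_form. cbv zeta.
  set (n := cross _ _).
  assert (hn : vnorm n ^ 2 = detg S s t).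
  { unfold vnorm. rewrite pow2_sqrt by apply dot_self_ge0.
    unfold n. apply dot_cross_self. }
  assert (hn0 : vnorm n <> 0).
  { intro h. rewrite h in hn. lra. }
  rewrite <- hn. field. auto.
Qed.

Lemma fE_smooth : smooth2_on (dom S) (fE S).
Proof.
  assert (hD := dom_open). assert (hX := pos_smooth).
  apply smooth2_dot; auto; now apply smooth2_vd1.
Qed.

Lemma fF_smooth : smooth2_on (dom S) (fF S).
Proof.
  assert (hD := dom_open). assert (hX := pos_smooth).
  apply smooth2_dot; auto; [now apply smooth2_vd1 | now apply smooth2_vd2].
Qed.

Lemma fG_smooth : smooth2_on (dom S) (fG S).
Proof.
  assert (hD := dom_open). assert (hX := pos_smooth).
  apply smooth2_dot; auto; now apply smooth2_vd2.
Qed.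

Lemma detg_smooth : smooth2_on (dom S) (detg S).
Proof.
  assert (hD := dom_open).
  assert (hE := fE_smooth). assert (hF := fF_smooth). assert (hG := fG_smooth).
  unfold detg. smooth2 hD.
Qed.

Lemma gauss_curvature_smooth : smooth2_on (dom S) (gauss_curvature S).
Proof.
  assert (hD := dom_open). assert (hX := pos_smooth). assert (hd := detg_smooth).
  apply (smooth2_agree _ hD (fun s t => curvature_form s t / detg S s t ^ 2)).
  - intros s t hst. symmetry. now apply gauss_curvature_eq.
  - assert (hn : smooth2_map (dom S)
              (fun s t => cross (vd1 (pos S) s t) (vd2 (pos S) s t))).
    { apply smooth2_cross; auto; [now apply smooth2_vd1 | now apply smooth2_vd2]. }
    assert (h1 := smooth2_vd1 _ _ hX). assert (h2 := smooth2_vd2 _ _ hX).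
    assert (h11 := smooth2_dot _ hD _ _ (smooth2_vd1 _ _ h1) hn).
    assert (h12 := smooth2_dot _ hD _ _ (smooth2_vd2 _ _ h1) hn).
    assert (h22 := smooth2_dot _ hD _ _ (smooth2_vd2 _ _ h2) hn).
    apply (smooth2_div _ hD).
    + intros s t hst. apply pow_nonzero.
      apply Rgt_not_eq. now apply detg_pos.
    + unfold curvature_form. cbv zeta. smooth2 hD.
    + smooth2 hD.
Qed.

Lemma grad1_smooth f : smooth2_on (dom S) f -> smooth2_on (dom S) (grad1 S f).
Proof.
  intro hf. assert (hD := dom_open). assert (hd := detg_smooth).
  assert (hF := fF_smooth). assert (hG := fG_smooth).
  apply (smooth2_div _ hD).
  - intros s t hst. apply Rgt_not_eq. now apply detg_pos.
  - smooth2 hD.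
  - smooth2 hD.
Qed.

Lemma grad2_smooth f : smooth2_on (dom S) f -> smooth2_on (dom S) (grad2 S f).
Proof.
  intro hf. assert (hD := dom_open). assert (hd := detg_smooth).
  assert (hE := fE_smooth). assert (hF := fF_smooth).
  apply (smooth2_div _ hD).
  - intros s t hst. apply Rgt_not_eq. now apply detg_pos.
  - smooth2 hD.
  - smooth2 hD.
Qed.

(** Carrying out the derivative of [sqrt det g] leaves no square root.  In this
form a change of coordinates enters only through the square of its Jacobian, so
its orientation never has to be discussed. *)
Lemma divergence_eq v w s t :
  smooth2_on (dom S) v -> smooth2_on (dom S) w -> dom S s t ->
  divergence S v w s t =
  d1 v s t + d2 w s t +
  (v s t * d1 (detg S) s t + w s t * d2 (detg S) s t) / (2 * detg S s t).
Proof.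
  intros hv hw hst. assert (hd := detg_smooth). assert (h0 := detg_pos s t hst).
  unfold divergence, d1 at 1, d2 at 1.
  rewrite (Derive_sqrt_mult (fun x => detg S x t) (fun x => v x t)); auto.
  2: now apply (smooth2_ex1 (dom S)).
  2: now apply (smooth2_ex1 (dom S)).
  rewrite (Derive_sqrt_mult (fun y => detg S s y) (fun y => w s y)); auto.
  2: now apply (smooth2_ex2 (dom S)).
  2: now apply (smooth2_ex2 (dom S)).
  fold (d1 v s t) (d2 w s t) (d1 (detg S) s t) (d2 (detg S) s t).
  assert (hs := sqrt_sqrt (detg S s t) (Rlt_le _ _ h0)).
  assert (hp := sqrt_lt_R0 _ h0).
  set (r := sqrt (detg S s t)) in *. rewrite <- hs. field. lra.
Qed.
End Curvature.

(** * Invariance under reparametrization *)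

(** In the following two sections [g] is the expression in new coordinates [(p, q)]
of a function [f], and the derivatives of [g] up to order two are expressed by
those of [f]. *)
Section Pullback.
Variables D D' : R -> R -> Prop.
Hypothesis hD : planar_open D.
Hypothesis hD' : planar_open D'.
Variables p q : R -> R -> R.
Hypothesis hp : smooth2_on D p.
Hypothesis hq : smooth2_on D q.
Hypothesis hpq : forall s t, D s t -> D' (p s t) (q s t).
Variables f g : R -> R -> R.
Hypothesis hf : smooth2_on D' f.
Hypothesis hg : agree D g (fun s t => f (p s t) (q s t)).

Lemma pullback_d1 :
  agree D (d1 g) (fun s t => d1 p s t * d1 f (p s t) (q s t)
                             + d1 q s t * d2 f (p s t) (q s t)).
Proof.
  intros s t hst. rewrite (d1_agree D hD _ _ hg s t hst).
  rewrite (d1_comp D D'); auto. ring.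
Qed.

Lemma pullback_d2 :
  agree D (d2 g) (fun s t => d2 p s t * d1 f (p s t) (q s t)
                             + d2 q s t * d2 f (p s t) (q s t)).
Proof.
  intros s t hst. rewrite (d2_agree D hD _ _ hg s t hst).
  rewrite (d2_comp D D'); auto. ring.
Qed.
End Pullback.

Section Pullback2.
Variables D D' : R -> R -> Prop.
Hypothesis hD : planar_open D.
Hypothesis hD' : planar_open D'.
Variables p q : R -> R -> R.
Hypothesis hp : smooth2_on D p.
Hypothesis hq : smooth2_on D q.
Hypothesis hpq : forall s t, D s t -> D' (p s t) (q s t).

Lemma smooth2_mult_comp f h :
  smooth2_on D' f -> smooth2_on D h ->
  smooth2_on D (fun s t => h s t * f (p s t) (q s t)).
Proof.
  intros hf hh. apply smooth2_mult; auto. now apply (smooth2_comp D D').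
Qed.

Lemma d1_mult_comp f h s t :
  smooth2_on D' f -> smooth2_on D h -> D s t ->
  d1 (fun s t => h s t * f (p s t) (q s t)) s t =
  d1 h s t * f (p s t) (q s t)
  + h s t * (d1 f (p s t) (q s t) * d1 p s t + d2 f (p s t) (q s t) * d1 q s t).
Proof.
  intros hf hh hst.
  rewrite (d1_mult D h (fun s t => f (p s t) (q s t))); auto.
  - now rewrite (d1_comp D D' hD hD' p q hp hq hpq f s t hf hst).
  - now apply (smooth2_comp D D').
Qed.

Lemma d2_mult_comp f h s t :
  smooth2_on D' f -> smooth2_on D h -> D s t ->
  d2 (fun s t => h s t * f (p s t) (q s t)) s t =
  d2 h s t * f (p s t) (q s t)
  + h s t * (d1 f (p s t) (q s t) * d2 p s t + d2 f (p s t) (q s t) * d2 q s t).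
Proof.
  intros hf hh hst.
  rewrite (d2_mult D h (fun s t => f (p s t) (q s t))); auto.
  - now rewrite (d2_comp D D' hD hD' p q hp hq hpq f s t hf hst).
  - now apply (smooth2_comp D D').
Qed.

Variables f g : R -> R -> R.
Hypothesis hf : smooth2_on D' f.
Hypothesis hg : agree D g (fun s t => f (p s t) (q s t)).

Let hf1 := smooth2_d1 D' f hf.
Let hf2 := smooth2_d2 D' f hf.

Lemma pullback_d11 s t : D s t ->
  d1 (d1 g) s t =
  d1 p s t ^ 2 * d1 (d1 f) (p s t) (q s t)
  + 2 * d1 p s t * d1 q s t * d2 (d1 f) (p s t) (q s t)
  + d1 q s t ^ 2 * d2 (d2 f) (p s t) (q s t)
  + d1 (d1 p) s t * d1 f (p s t) (q s t)
  + d1 (d1 q) s t * d2 f (p s t) (q s t).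
Proof.
  intro hst.
  rewrite (d1_agree D hD _ _ (pullback_d1 D D' hD hD' p q hp hq hpq f g hf hg) s t hst).
  rewrite (d1_plus D); auto.
  2: now apply smooth2_mult_comp; auto; apply smooth2_d1.
  2: now apply smooth2_mult_comp; auto; apply smooth2_d1.
  rewrite !d1_mult_comp; auto; try now apply smooth2_d1.
  rewrite (smooth2_schwarz D' hD' f); auto. ring.
Qed.

Lemma pullback_d21 s t : D s t ->
  d2 (d1 g) s t =
  d1 p s t * d2 p s t * d1 (d1 f) (p s t) (q s t)
  + (d1 p s t * d2 q s t + d2 p s t * d1 q s t) * d2 (d1 f) (p s t) (q s t)
  + d1 q s t * d2 q s t * d2 (d2 f) (p s t) (q s t)
  + d2 (d1 p) s t * d1 f (p s t) (q s t)
  + d2 (d1 q) s t * d2 f (p s t) (q s t).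
Proof.
  intro hst.
  rewrite (d2_agree D hD _ _ (pullback_d1 D D' hD hD' p q hp hq hpq f g hf hg) s t hst).
  rewrite (d2_plus D); auto.
  2: now apply smooth2_mult_comp; auto; apply smooth2_d1.
  2: now apply smooth2_mult_comp; auto; apply smooth2_d1.
  rewrite !d2_mult_comp; auto; try now apply smooth2_d1.
  rewrite (smooth2_schwarz D' hD' f); auto. ring.
Qed.

Lemma pullback_d22 s t : D s t ->
  d2 (d2 g) s t =
  d2 p s t ^ 2 * d1 (d1 f) (p s t) (q s t)
  + 2 * d2 p s t * d2 q s t * d2 (d1 f) (p s t) (q s t)
  + d2 q s t ^ 2 * d2 (d2 f) (p s t) (q s t)
  + d2 (d2 p) s t * d1 f (p s t) (q s t)
  + d2 (d2 q) s t * d2 f (p s t) (q s t).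
Proof.
  intro hst.
  rewrite (d2_agree D hD _ _ (pullback_d2 D D' hD hD' p q hp hq hpq f g hf hg) s t hst).
  rewrite (d2_plus D); auto.
  2: now apply smooth2_mult_comp; auto; apply smooth2_d2.
  2: now apply smooth2_mult_comp; auto; apply smooth2_d2.
  rewrite !d2_mult_comp; auto; try now apply smooth2_d2.
  rewrite (smooth2_schwarz D' hD' f); auto. ring.
Qed.
End Pullback2.

Section Reparametrization.
Variables S T : surface.
Hypothesis hS : immersed S.
Hypothesis hT : immersed T.
Variables p q : R -> R -> R.
Hypothesis hp : smooth2_on (dom T) p.
Hypothesis hq : smooth2_on (dom T) q.
Hypothesis hpq : forall s t, dom T s t -> dom S (p s t) (q s t).
Hypothesis hpos : forall s t, dom T s t -> pos T s t = pos S (p s t) (q s t).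

Definition jacobian (s t : R) : R := d1 p s t * d2 q s t - d2 p s t * d1 q s t.

Let hDS := dom_open S hS.
Let hDT := dom_open T hT.

Lemma pos_coord (c : R3 -> R) :
  agree (dom T) (fun s t => c (pos T s t)) (fun s t => c (pos S (p s t) (q s t))).
Proof. intros s t hst. now rewrite hpos. Qed.

Ltac coordinatewise lem hst :=
  apply R3_eq;
  [ exact (lem _ _ hDT hDS p q hp hq hpq _ _ (proj1 (pos_smooth S hS))
             (pos_coord px) _ _ hst)
  | exact (lem _ _ hDT hDS p q hp hq hpq _ _ (proj1 (proj2 (pos_smooth S hS)))
             (pos_coord py) _ _ hst)
  | exact (lem _ _ hDT hDS p q hp hq hpq _ _ (proj2 (proj2 (pos_smooth S hS)))
             (pos_coord pz) _ _ hst) ].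

Lemma reparam_vd1 s t : dom T s t ->
  vd1 (pos T) s t =
  plus (scal (d1 p s t) (vd1 (pos S) (p s t) (q s t)))
       (scal (d1 q s t) (vd2 (pos S) (p s t) (q s t))).
Proof. intro hst. coordinatewise pullback_d1 hst. Qed.

Lemma reparam_vd2 s t : dom T s t ->
  vd2 (pos T) s t =
  plus (scal (d2 p s t) (vd1 (pos S) (p s t) (q s t)))
       (scal (d2 q s t) (vd2 (pos S) (p s t) (q s t))).
Proof. intro hst. coordinatewise pullback_d2 hst. Qed.

(** The shape shared by the three second derivatives of the position in new
coordinates.  The terms in [b1] and [b2] are tangent to the surface and
disappear against the normal ([second_order_dot]). *)
Definition second_order (a11 a12 a22 b1 b2 s t : R) : R3 :=
  plus (plus (plus (plus
    (scal a11 (vd1 (vd1 (pos S)) s t))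
    (scal a12 (vd2 (vd1 (pos S)) s t)))
    (scal a22 (vd2 (vd2 (pos S)) s t)))
    (scal b1 (vd1 (pos S) s t)))
    (scal b2 (vd2 (pos S) s t)).

Lemma reparam_vd11 s t : dom T s t ->
  vd1 (vd1 (pos T)) s t =
  second_order (d1 p s t ^ 2) (2 * d1 p s t * d1 q s t) (d1 q s t ^ 2)
    (d1 (d1 p) s t) (d1 (d1 q) s t) (p s t) (q s t).
Proof. intro hst. coordinatewise pullback_d11 hst. Qed.

Lemma reparam_vd21 s t : dom T s t ->
  vd2 (vd1 (pos T)) s t =
  second_order (d1 p s t * d2 p s t)
    (d1 p s t * d2 q s t + d2 p s t * d1 q s t) (d1 q s t * d2 q s t)
    (d2 (d1 p) s t) (d2 (d1 q) s t) (p s t) (q s t).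
Proof. intro hst. coordinatewise pullback_d21 hst. Qed.

Lemma reparam_vd22 s t : dom T s t ->
  vd2 (vd2 (pos T)) s t =
  second_order (d2 p s t ^ 2) (2 * d2 p s t * d2 q s t) (d2 q s t ^ 2)
    (d2 (d2 p) s t) (d2 (d2 q) s t) (p s t) (q s t).
Proof. intro hst. coordinatewise pullback_d22 hst. Qed.

(** The normal direction is multiplied by the Jacobian; both fundamental forms
inherit their transformation rules from this. *)
Lemma reparam_cross s t : dom T s t ->
  cross (vd1 (pos T) s t) (vd2 (pos T) s t) =
  scal (jacobian s t)
    (cross (vd1 (pos S) (p s t) (q s t)) (vd2 (pos S) (p s t) (q s t))).
Proof.
  intro hst. rewrite reparam_vd1, reparam_vd2 by assumption.
  unfold jacobian.
  generalize (vd1 (pos S) (p s t) (q s t)), (vd2 (pos S) (p s t) (q s t)).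
  intros v w. apply R3_eq; coords; ring.
Qed.

Lemma second_order_dot a11 a12 a22 b1 b2 s t c :
  let n := cross (vd1 (pos S) s t) (vd2 (pos S) s t) in
  dot (second_order a11 a12 a22 b1 b2 s t) (scal c n) =
  c * (a11 * dot (vd1 (vd1 (pos S)) s t) n + a12 * dot (vd2 (vd1 (pos S)) s t) n
       + a22 * dot (vd2 (vd2 (pos S)) s t) n).
Proof.
  unfold second_order. cbv zeta.
  generalize (vd1 (pos S) s t), (vd2 (pos S) s t), (vd1 (vd1 (pos S)) s t),
    (vd2 (vd1 (pos S)) s t), (vd2 (vd2 (pos S)) s t).
  intros v w x y z. coords. ring.
Qed.

Lemma reparam_fE s t : dom T s t ->
  fE T s t = fE S (p s t) (q s t) * d1 p s t ^ 2
    + 2 * fF S (p s t) (q s t) * d1 p s t * d1 q s t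
    + fG S (p s t) (q s t) * d1 q s t ^ 2.
Proof.
  intro hst. unfold fE, fF, fG. rewrite reparam_vd1 by assumption. coords. ring.
Qed.

Lemma reparam_fF s t : dom T s t ->
  fF T s t = fE S (p s t) (q s t) * d1 p s t * d2 p s t
    + fF S (p s t) (q s t) * (d1 p s t * d2 q s t + d2 p s t * d1 q s t)
    + fG S (p s t) (q s t) * d1 q s t * d2 q s t.
Proof.
  intro hst. unfold fE, fF, fG. rewrite reparam_vd1, reparam_vd2 by assumption.
  coords. ring.
Qed.

Lemma reparam_fG s t : dom T s t ->
  fG T s t = fE S (p s t) (q s t) * d2 p s t ^ 2
    + 2 * fF S (p s t) (q s t) * d2 p s t * d2 q s t
    + fG S (p s t) (q s t) * d2 q s t ^ 2.
Proof.
  intro hst. unfold fE, fF, fG. rewrite reparam_vd2 by assumption. coords. ring.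
Qed.

Lemma reparam_detg s t : dom T s t ->
  detg T s t = jacobian s t ^ 2 * detg S (p s t) (q s t).
Proof.
  intro hst. unfold detg.
  rewrite reparam_fE, reparam_fF, reparam_fG by assumption.
  unfold jacobian. ring.
Qed.

(** The determinant of the metric is multiplied by the square of the Jacobian and is
positive on both sides. *)
Lemma jacobian_neq0 s t : dom T s t -> jacobian s t <> 0.
Proof.
  intros hst h. assert (hd := detg_pos T hT s t hst).
  rewrite reparam_detg, h in hd by assumption. lra.
Qed.

(** Numerator and denominator of the curvature are both multiplied by the fourth
power of the Jacobian. *)
Lemma reparam_gauss_curvature s t : dom T s t ->
  gauss_curvature T s t = gauss_curvature S (p s t) (q s t).
Proof.
  intro hst. assert (hj := jacobian_neq0 s t hst).
  assert (hd := detg_pos S hS _ _ (hpq s t hst)).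
  rewrite !gauss_curvature_eq by auto.
  rewrite reparam_detg by assumption. unfold curvature_form.
  rewrite reparam_cross, reparam_vd11, reparam_vd21, reparam_vd22 by assumption.
  cbv zeta. rewrite !second_order_dot.
  change (jacobian s t) with (d1 p s t * d2 q s t - d2 p s t * d1 q s t) in *.
  field. split; [lra | exact hj].
Qed.

(** The gradient is a vector field on the surface: its components in the two charts
correspond under the differential of [(p, q)]. *)
Lemma reparam_gradient f g s t :
  smooth2_on (dom S) f ->
  agree (dom T) g (fun s t => f (p s t) (q s t)) ->
  dom T s t ->
  grad1 S f (p s t) (q s t) =
    d1 p s t * grad1 T g s t + d2 p s t * grad2 T g s t /\
  grad2 S f (p s t) (q s t) =
    d1 q s t * grad1 T g s t + d2 q s t * grad2 T g s t.
Proof.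
  intros hf hg hst.
  assert (hj := jacobian_neq0 s t hst).
  assert (hd := detg_pos S hS _ _ (hpq s t hst)).
  assert (h1 := pullback_d1 _ _ hDT hDS p q hp hq hpq f g hf hg s t hst).
  assert (h2 := pullback_d2 _ _ hDT hDS p q hp hq hpq f g hf hg s t hst).
  cbv beta in h1, h2.
  unfold grad1, grad2. rewrite h1, h2, reparam_detg by assumption.
  rewrite reparam_fE, reparam_fF, reparam_fG by assumption.
  assert (hd' : detg S (p s t) (q s t) <> 0) by lra.
  revert hj hd'. unfold detg, jacobian. intros. split; field; auto.
Qed.

Lemma reparam_metric_norm2 v w v' w' s t :
  v (p s t) (q s t) = d1 p s t * v' s t + d2 p s t * w' s t ->
  w (p s t) (q s t) = d1 q s t * v' s t + d2 q s t * w' s t ->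
  dom T s t ->
  metric_norm2 T v' w' s t = metric_norm2 S v w (p s t) (q s t).
Proof.
  intros hv hw hst. unfold metric_norm2.
  rewrite hv, hw, reparam_fE, reparam_fF, reparam_fG by assumption. ring.
Qed.

(** For fields related by the differential [D] of [(p, q)], differentiating this
relation expresses the trace of the derivative in one chart by that in the
other, with the error term [tr (D' D^-1)].  That term is the logarithmic
derivative of the Jacobian, which the density [det g] contributes with the
opposite sign. *)
Lemma reparam_divergence v w v' w' s t :
  smooth2_on (dom S) v -> smooth2_on (dom S) w ->
  smooth2_on (dom T) v' -> smooth2_on (dom T) w' ->
  (forall s t, dom T s t ->
     v (p s t) (q s t) = d1 p s t * v' s t + d2 p s t * w' s t) ->
  (forall s t, dom T s t ->
     w (p s t) (q s t) = d1 q s t * v' s t + d2 q s t * w' s t) ->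
  dom T s t ->
  divergence T v' w' s t = divergence S v w (p s t) (q s t).
Proof.
  intros hv hw hv' hw' ev ew hst.
  assert (hj := jacobian_neq0 s t hst).
  assert (hd := detg_pos S hS _ _ (hpq s t hst)).
  rewrite (divergence_eq T hT v' w'), (divergence_eq S hS v w) by auto.
  assert (sp1 := smooth2_d1 _ _ hp). assert (sp2 := smooth2_d2 _ _ hp).
  assert (sq1 := smooth2_d1 _ _ hq). assert (sq2 := smooth2_d2 _ _ hq).
  assert (hev : agree (dom T) (fun s t => d1 p s t * v' s t + d2 p s t * w' s t)
                 (fun s t => v (p s t) (q s t)))
    by (intros x y h; symmetry; now apply ev).
  assert (hew : agree (dom T) (fun s t => d1 q s t * v' s t + d2 q s t * w' s t)
                 (fun s t => w (p s t) (q s t)))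
    by (intros x y h; symmetry; now apply ew).
  assert (hed : agree (dom T) (detg T)
     (fun s t => jacobian s t * jacobian s t * detg S (p s t) (q s t))).
  { intros x y h. rewrite reparam_detg by assumption. ring. }
  assert (hdS := detg_smooth S hS).
  assert (hJ : smooth2_on (dom T) jacobian) by (unfold jacobian; smooth2 hDT).
  assert (hJJ : smooth2_on (dom T) (fun s t => jacobian s t * jacobian s t))
    by smooth2 hDT.
  assert (v1 := pullback_d1 _ _ hDT hDS p q hp hq hpq v _ hv hev s t hst).
  assert (v2 := pullback_d2 _ _ hDT hDS p q hp hq hpq v _ hv hev s t hst).
  assert (w1 := pullback_d1 _ _ hDT hDS p q hp hq hpq w _ hw hew s t hst).
  assert (w2 := pullback_d2 _ _ hDT hDS p q hp hq hpq w _ hw hew s t hst).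
  cbv beta in v1, v2, w1, w2.
  rewrite (d1_plus (dom T)), !(d1_mult (dom T)) in v1, w1 by (try smooth2 hDT; auto).
  rewrite (d2_plus (dom T)), !(d2_mult (dom T)) in v2, w2 by (try smooth2 hDT; auto).
  rewrite (d1_agree _ hDT _ _ hed s t hst), (d2_agree _ hDT _ _ hed s t hst).
  rewrite (d1_mult_comp _ _ hDT hDS p q hp hq hpq (detg S)) by assumption.
  rewrite (d2_mult_comp _ _ hDT hDS p q hp hq hpq (detg S)) by assumption.
  rewrite !(d1_mult (dom T)), !(d2_mult (dom T)) by assumption.
  rewrite reparam_detg by assumption.
  rewrite (ev s t hst), (ew s t hst).
  assert (j1 : d1 jacobian s t =
     d1 (d1 p) s t * d2 q s t + d1 p s t * d2 (d1 q) s t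
     - d2 (d1 p) s t * d1 q s t - d2 p s t * d1 (d1 q) s t).
  { unfold jacobian.
    rewrite (d1_minus (dom T)), !(d1_mult (dom T)) by (auto; smooth2 hDT).
    rewrite (smooth2_schwarz _ hDT p s t hp hst), (smooth2_schwarz _ hDT q s t hq hst).
    ring. }
  assert (j2 : d2 jacobian s t =
     d2 (d1 p) s t * d2 q s t + d1 p s t * d2 (d2 q) s t
     - d2 (d2 p) s t * d1 q s t - d2 p s t * d2 (d1 q) s t).
  { unfold jacobian.
    rewrite (d2_minus (dom T)), !(d2_mult (dom T)) by (auto; smooth2 hDT).
    ring. }
  rewrite j1, j2.
  rewrite (smooth2_schwarz _ hDT p s t hp hst) in v1.
  rewrite (smooth2_schwarz _ hDT q s t hq hst) in w1.
  (* The diagonal entries of the derivative of [(v, w)], by Cramer's rule from the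
     derivatives along the new coordinates. *)
  assert (eA : d1 v (p s t) (q s t) =
     (d2 q s t * (d1 p s t * d1 v (p s t) (q s t) + d1 q s t * d2 v (p s t) (q s t))
      - d1 q s t * (d2 p s t * d1 v (p s t) (q s t) + d2 q s t * d2 v (p s t) (q s t)))
     / jacobian s t)
    by (revert hj; unfold jacobian; intro; field; assumption).
  assert (eB : d2 w (p s t) (q s t) =
     (d1 p s t * (d2 p s t * d1 w (p s t) (q s t) + d2 q s t * d2 w (p s t) (q s t))
      - d2 p s t * (d1 p s t * d1 w (p s t) (q s t) + d1 q s t * d2 w (p s t) (q s t)))
     / jacobian s t)
    by (revert hj; unfold jacobian; intro; field; assumption).
  rewrite <- v1, <- v2 in eA. rewrite <- w1, <- w2 in eB.
  rewrite eA, eB. clear - hj hd.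
  revert hj. unfold jacobian. intro. field. split; [lra | assumption].
Qed.

Lemma reparam_ricci_condition : ricci_condition S -> ricci_condition T.
Proof.
  intros hR s t hst. cbv zeta.
  assert (hR' := hR _ _ (hpq s t hst)). cbv zeta in hR'.
  assert (hK := gauss_curvature_smooth S hS).
  assert (hK' := gauss_curvature_smooth T hT).
  assert (eK : agree (dom T) (gauss_curvature T)
                 (fun s t => gauss_curvature S (p s t) (q s t)))
    by (intros x y h; now apply reparam_gauss_curvature).
  unfold laplacian in *.
  rewrite (reparam_divergence (grad1 S (gauss_curvature S))
             (grad2 S (gauss_curvature S))); auto.
  - rewrite (reparam_metric_norm2 (grad1 S (gauss_curvature S))
             (grad2 S (gauss_curvature S))); auto.
    + rewrite reparam_gauss_curvature by assumption. exact hR'.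
    + exact (proj1 (reparam_gradient _ _ s t hK eK hst)).
    + exact (proj2 (reparam_gradient _ _ s t hK eK hst)).
  - now apply grad1_smooth.
  - now apply grad2_smooth.
  - now apply grad1_smooth.
  - now apply grad2_smooth.
  - intros x y h. exact (proj1 (reparam_gradient _ _ x y hK eK h)).
  - intros x y h. exact (proj2 (reparam_gradient _ _ x y hK eK h)).
Qed.
End Reparametrization.

Lemma same_surface_sym S T : same_surface S T -> same_surface T S.
Proof.
  intros (p & q & (p' & q' & hp & hq & hp' & hq' & h & h') & hpos).
  exists p', q'. split.
  - exists p, q. repeat split; try assumption.
    + now apply h'.
    + now apply h'.
    + now apply h'.
    + now apply h.
    + now apply h.
    + now apply h.
  - intros s t hst. destruct (h' s t hst) as (hd & e1 & e2).
    rewrite hpos by assumption. now rewrite e1, e2.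
Qed.

Lemma same_surface_ricci S T :
  immersed S -> immersed T -> same_surface T S ->
  ricci_condition S -> ricci_condition T.
Proof.
  intros hS hT (p & q & (p' & q' & hp & hq & hp' & hq' & h & h') & hpos).
  apply (reparam_ricci_condition S T hS hT p q); auto.
  intros s t hst. now apply h.
Qed.

Lemma same_surface_curvature S T s t :
  immersed S -> immersed T -> same_surface T S -> dom T s t ->
  exists s' t', dom S s' t' /\ gauss_curvature T s t = gauss_curvature S s' t'.
Proof.
  intros hS hT (p & q & (p' & q' & hp & hq & hp' & hq' & h & h') & hpos) hst.
  exists (p s t), (q s t). split; [now apply h|].
  apply (reparam_gauss_curvature S T hS hT p q); auto.
  intros x y hxy. now apply h.
Qed.

(** * Functions and curves on an interval *)

Lemma open_interval_open I : open_interval I -> open I.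
Proof.
  intros (a & b & _ & hI) t ht.
  apply (filter_imp (fun t : R => Rbar_lt a t /\ Rbar_lt t b)).
  - intros x hx. now apply hI.
  - apply hI in ht. exact (open_and _ _ (open_Rbar_gt a) (open_Rbar_lt b) t ht).
Qed.

Lemma open_interval_inhabited I : open_interval I -> exists t, I t.
Proof.
  intros (a & b & hab & hI).
  assert (h : exists t : R, Rbar_lt a t /\ Rbar_lt t b).
  { destruct a as [a| |], b as [b| |]; simpl in *; try easy.
    - exists ((a + b) / 2). lra.
    - exists (a + 1). lra.
    - exists (b - 1). lra.
    - exists 0. easy. }
  destruct h as [t ht]. exists t. now apply hI.
Qed.

Lemma open_interval_between I x y z :
  open_interval I -> I x -> I y -> x <= z <= y -> I z.
Proof.
  intros (a & b & _ & hI) hx hy hz. apply hI in hx, hy. apply hI.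
  destruct a as [a| |], b as [b| |]; simpl in *; intuition; lra.
Qed.

Lemma strip_open I (hI : open I) : planar_open (fun s _ => I s).
Proof. apply (open_comp fst); [|exact hI]. intros; apply continuous_fst. Qed.

Lemma box_open I J : open_interval I -> open_interval J ->
  planar_open (fun t u => I t /\ J u).
Proof.
  intros hI hJ. apply open_and.
  - apply (open_comp fst); [intros; apply continuous_fst | now apply open_interval_open].
  - apply (open_comp snd); [intros; apply continuous_snd | now apply open_interval_open].
Qed.

Lemma smooth_on_Derive I f : smooth_on I f -> smooth_on I (Derive f).
Proof.
  intros hf n t ht. assert (h := hf (S n) t ht). destruct n as [|n]; [exact Logic.I|].
  simpl in *. apply (ex_derive_ext (Derive_n f (S n))).
  - intro s. change (Derive f) with (Derive_n f 1).
    rewrite Derive_n_comp. now rewrite Nat.add_comm.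
  - exact h.
Qed.

Lemma smooth_on_ex I f t : smooth_on I f -> I t -> ex_derive f t.
Proof. intros hf. exact (hf 1%nat t). Qed.

(** Functions of one variable are treated as functions of two that do not depend on
the second.  The closure properties already proved then serve for both, the
way back being [smooth2_smooth_on]. *)
Lemma smooth_on_smooth2 (I : R -> Prop) (D : R -> R -> Prop) (hD : planar_open D) f :
  (forall s t, D s t -> I s) -> smooth_on I f -> smooth2_on D (fun s _ => f s).
Proof.
  intros hDI hf n. revert f hf. induction n as [|n IH]; intros f hf.
  - intros s t hst. split; [|exact Logic.I].
    apply (continuity_1d_2d_pt_comp f (fun s _ => s)).
    + apply continuity_pt_filterlim, (@ex_derive_continuous R_AbsRing R_NormedModule).
      apply (smooth_on_ex I); eauto.
    + apply continuity_2d_pt_id1.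
  - apply diff_on_S.
    + intros s t hst. apply (continuity_1d_2d_pt_comp f (fun s _ => s)).
      * apply continuity_pt_filterlim, (@ex_derive_continuous R_AbsRing R_NormedModule).
        apply (smooth_on_ex I); eauto.
      * apply continuity_2d_pt_id1.
    + intros s t hst. apply (smooth_on_ex I); eauto.
    + intros s t hst. apply @ex_derive_const.
    + exact (IH _ (smooth_on_Derive I f hf)).
    + apply (diff_on_agree n D hD (fun _ _ => 0)).
      * intros s t _. unfold d2. now rewrite Derive_const.
      * apply diff_on_const.
Qed.

Lemma smooth2_smooth_on I (hI : open I) f :
  smooth2_on (fun s _ => I s) (fun s _ => f s) -> smooth_on I f.
Proof.
  intros hf.
  assert (h : forall n, smooth2_on (fun s _ => I s) (fun s _ => Derive_n f n s)).
  { induction n as [|n IH]; [exact hf|]. exact (smooth2_d1 _ _ IH). }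
  intros [|n] t ht; [exact Logic.I|].
  exact (smooth2_ex1 _ _ t 0 (h n) ht).
Qed.

Lemma smooth_curve_vderive I c : smooth_curve I c -> smooth_curve I (vderive c).
Proof.
  intros (h1 & h2 & h3). split; [|split].
  - exact (smooth_on_Derive _ _ h1).
  - exact (smooth_on_Derive _ _ h2).
  - exact (smooth_on_Derive _ _ h3).
Qed.

Lemma smooth_curve_dot I (hI : open I) c d :
  smooth_curve I c -> smooth_curve I d -> smooth_on I (fun t => dot (c t) (d t)).
Proof.
  intros (h1 & h2 & h3) (k1 & k2 & k3).
  apply (smooth2_smooth_on I hI). assert (hD := strip_open I hI).
  assert (lift := fun f => smooth_on_smooth2 I (fun s _ => I s) hD f (fun s t h => h)).
  apply lift in h1, h2, h3, k1, k2, k3.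
  unfold dot. smooth2 hD.
Qed.

Lemma smooth_curve_cross I (hI : open I) c d :
  smooth_curve I c -> smooth_curve I d -> smooth_curve I (fun t => cross (c t) (d t)).
Proof.
  intros (h1 & h2 & h3) (k1 & k2 & k3).
  assert (hD := strip_open I hI).
  assert (lift := fun f => smooth_on_smooth2 I (fun s _ => I s) hD f (fun s t h => h)).
  apply lift in h1, h2, h3, k1, k2, k3.
  unfold cross; split; [|split]; apply (smooth2_smooth_on I hI);
    unfold px, py, pz in *; simpl; smooth2 hD.
Qed.

Lemma Derive_dot I c d t :
  smooth_curve I c -> smooth_curve I d -> I t ->
  Derive (fun t => dot (c t) (d t)) t =
  dot (vderive c t) (d t) + dot (c t) (vderive d t).
Proof.
  intros (h1 & h2 & h3) (k1 & k2 & k3) ht.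
  apply (fun h => smooth_on_ex _ _ t h ht) in h1, h2, h3, k1, k2, k3.
  apply is_derive_unique. unfold dot.
  unfold vderive.
  set (f1 := fun s => px (c s)) in *. set (f2 := fun s => py (c s)) in *.
  set (f3 := fun s => pz (c s)) in *. set (g1 := fun s => px (d s)) in *.
  set (g2 := fun s => py (d s)) in *. set (g3 := fun s => pz (d s)) in *.
  change (is_derive (fun t => f1 t * g1 t + f2 t * g2 t + f3 t * g3 t) t
    (Derive f1 t * g1 t + Derive f2 t * g2 t + Derive f3 t * g3 t +
     (f1 t * Derive g1 t + f2 t * Derive g2 t + f3 t * Derive g3 t))).
  clearbody f1 f2 f3 g1 g2 g3.
  auto_derive; [tauto|].
  change (fun x => f1 x) with f1. change (fun x => f2 x) with f2.
  change (fun x => f3 x) with f3. change (fun x => g1 x) with g1.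
  change (fun x => g2 x) with g2. change (fun x => g3 x) with g3. ring.
Qed.

Lemma Derive_locally_const I (hI : open I) f c t :
  (forall s, I s -> f s = c) -> I t -> Derive f t = 0.
Proof.
  intros h ht. rewrite (Derive_ext_loc f (fun _ => c)).
  - apply Derive_const.
  - apply (filter_imp I); [exact h | now apply hI].
Qed.

Lemma constant_of_is_derive I f :
  open_interval I -> (forall t, I t -> is_derive f t 0) ->
  forall s t, I s -> I t -> f s = f t.
Proof.
  intros hI h.
  assert (w : forall s t, I s -> I t -> s < t -> f s = f t).
  { intros s t hs ht hst. apply (@eq_is_derive R_NormedModule); [|exact hst].
    intros x hx. apply h. exact (open_interval_between I s t x hI hs ht hx). }
  intros s t hs ht. destruct (Rtotal_order s t) as [hst | [-> | hst]]; auto.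
  symmetry. auto.
Qed.

Lemma constant_of_Derive I f :
  open_interval I -> smooth_on I f -> (forall t, I t -> Derive f t = 0) ->
  forall s t, I s -> I t -> f s = f t.
Proof.
  intros hI hf h. apply constant_of_is_derive; [exact hI|].
  intros t ht. rewrite <- (h t ht). apply Derive_correct.
  exact (smooth_on_ex I f t hf ht).
Qed.

Lemma smooth_curve_const I v : smooth_curve I (fun _ => v).
Proof.
  assert (h : forall c, smooth_on I (fun _ => c)).
  { intros c n t _. destruct n as [|n]; [exact Logic.I|].
    apply (ex_derive_n_const c (S n)). }
  split; [|split]; apply h.
Qed.

Lemma vderive_const v t : vderive (fun _ => v) t = zero.
Proof. unfold vderive. rewrite !Derive_const. reflexivity. Qed.

(** Rotating [(f, f')] back by the angle [t] gives a constant vector [(A, B)]. *)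
Lemma harmonic_solution I f :
  open_interval I -> smooth_on I f ->
  (forall t, I t -> Derive (Derive f) t = - f t) ->
  exists A B, forall t, I t ->
    f t = cos t * A + sin t * B /\ Derive f t = - sin t * A + cos t * B.
Proof.
  intros hI hf h.
  destruct (open_interval_inhabited I hI) as [t0 ht0].
  assert (hf' := smooth_on_Derive I f hf).
  assert (hA : forall t, I t -> is_derive (fun t => cos t * f t - sin t * Derive f t) t 0).
  { intros t ht. assert (e1 := smooth_on_ex _ _ t hf ht).
    assert (e2 := smooth_on_ex _ _ t hf' ht). specialize (h t ht).
    assert (hg : exists g, g = Derive f) by eauto. destruct hg as [g hg].
    rewrite <- hg in *.
    auto_derive; [tauto|].
    replace (Derive (fun x => f x) t) with (g t) by (now rewrite hg).
    change (fun x => g x) with g. rewrite h. ring. }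
  assert (hB : forall t, I t -> is_derive (fun t => sin t * f t + cos t * Derive f t) t 0).
  { intros t ht. assert (e1 := smooth_on_ex _ _ t hf ht).
    assert (e2 := smooth_on_ex _ _ t hf' ht). specialize (h t ht).
    assert (hg : exists g, g = Derive f) by eauto. destruct hg as [g hg].
    rewrite <- hg in *.
    auto_derive; [tauto|].
    replace (Derive (fun x => f x) t) with (g t) by (now rewrite hg).
    change (fun x => g x) with g. rewrite h. ring. }
  exists (cos t0 * f t0 - sin t0 * Derive f t0), (sin t0 * f t0 + cos t0 * Derive f t0).
  intros t ht.
  rewrite (constant_of_is_derive I _ hI hA t0 t ht0 ht),
    (constant_of_is_derive I _ hI hB t0 t ht0 ht).
  assert (e := sin2_cos2 t). unfold Rsqr in e. split.
  - transitivity ((sin t * sin t + cos t * cos t) * f t); [rewrite e|]; ring.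
  - transitivity ((sin t * sin t + cos t * cos t) * Derive f t); [rewrite e|]; ring.
Qed.

Lemma affine_solution I f k :
  open_interval I -> smooth_on I f -> (forall t, I t -> Derive f t = k) ->
  exists A, forall t, I t -> f t = A + t * k.
Proof.
  intros hI hf h.
  destruct (open_interval_inhabited I hI) as [t0 ht0].
  assert (hA : forall t, I t -> is_derive (fun t => f t - t * k) t 0).
  { intros t ht. assert (e1 := smooth_on_ex _ _ t hf ht). specialize (h t ht).
    auto_derive; [tauto|]. change (fun x => f x) with f. rewrite h. ring. }
  exists (f t0 - t0 * k). intros t ht.
  assert (e := constant_of_is_derive I _ hI hA t t0 ht ht0). simpl in e. lra.
Qed.

Lemma smooth_on_trig I A B : smooth_on I (fun t => A * cos t + B * sin t).
Proof.
  assert (h : forall n, exists A' B', forall t,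
     Derive_n (fun t => A * cos t + B * sin t) n t = A' * cos t + B' * sin t).
  { induction n as [|n (A' & B' & IH)]; [now exists A, B|].
    exists B', (- A'). intro t. simpl. rewrite (Derive_ext _ _ t IH).
    apply is_derive_unique. auto_derive; [exact Logic.I|]. ring. }
  intros [|n] t _; [exact Logic.I|]. destruct (h n) as (A' & B' & e). simpl.
  apply (ex_derive_ext (fun t => A' * cos t + B' * sin t)); [now symmetry|].
  auto_derive. exact Logic.I.
Qed.

Lemma smooth_on_affine I A B : smooth_on I (fun t => A + B * t).
Proof.
  assert (h : forall n, exists A' B', forall t,
     Derive_n (fun t => A + B * t) n t = A' + B' * t).
  { induction n as [|n (A' & B' & IH)]; [now exists A, B|].
    exists B', 0. intro t. simpl. rewrite (Derive_ext _ _ t IH).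
    apply is_derive_unique. auto_derive; [exact Logic.I|]. ring. }
  intros [|n] t _; [exact Logic.I|]. destruct (h n) as (A' & B' & e). simpl.
  apply (ex_derive_ext (fun t => A' + B' * t)); [now symmetry|].
  auto_derive. exact Logic.I.
Qed.

(** * The metric and curvature of a ruled patch *)

Section RuledPatch.
Variables I J : R -> Prop.
Variables alpha beta : R -> R3.
Hypothesis hI : open_interval I.
Hypothesis hJ : open_interval J.
Hypothesis ha : smooth_curve I alpha.
Hypothesis hb : smooth_curve I beta.
Hypothesis hn : forall t, I t ->
     vnorm (beta t) = 1 /\ vnorm (vderive beta t) = 1 /\
     dot (vderive alpha t) (vderive beta t) = 0.

Let hIo := open_interval_open I hI.

Lemma beta_unit t : I t -> dot (beta t) (beta t) = 1.
Proof. intro ht. apply vnorm_1. now apply hn. Qed.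

Lemma beta'_unit t : I t -> dot (vderive beta t) (vderive beta t) = 1.
Proof. intro ht. apply vnorm_1. now apply hn. Qed.

Lemma alpha'_beta' t : I t -> dot (vderive alpha t) (vderive beta t) = 0.
Proof. intro ht. now apply hn. Qed.

Lemma beta_beta' t : I t -> dot (beta t) (vderive beta t) = 0.
Proof.
  intro ht.
  assert (h := Derive_locally_const I hIo _ _ t beta_unit ht).
  rewrite (Derive_dot I) in h by assumption.
  rewrite (dot_comm (vderive beta t)) in h. lra.
Qed.

(** The component of [alpha'] along [beta ^ beta'], written without that vector. *)
Definition distribution t := dot (cross (vderive alpha t) (beta t)) (vderive beta t).

Definition drift t := dot (vderive alpha t) (beta t).

Lemma cross_alpha'_beta t : I t ->
  cross (vderive alpha t) (beta t) = scal (distribution t) (vderive beta t).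
Proof.
  intro ht. apply cross_along.
  - now apply alpha'_beta'.
  - now apply beta_beta'.
  - now apply beta'_unit.
Qed.

(** [alpha'] has no component along [beta'], so the distribution parameter and the
drift are its only coordinates; the identity is that of Lagrange for
[alpha' ^ beta]. *)
Lemma alpha'_norm2 t : I t ->
  dot (vderive alpha t) (vderive alpha t) = distribution t ^ 2 + drift t ^ 2.
Proof.
  intro ht. assert (h := dot_cross_self (vderive alpha t) (beta t)).
  rewrite cross_alpha'_beta in h by assumption.
  rewrite beta_unit, dot_scal_r, dot_comm, dot_scal_r, beta'_unit in h by assumption.
  unfold drift. lra.
Qed.

Lemma distribution_smooth : smooth_on I distribution.
Proof.
  apply (smooth_curve_dot I hIo (fun t => cross (vderive alpha t) (beta t))).
  - apply smooth_curve_cross; auto. now apply smooth_curve_vderive.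
  - now apply smooth_curve_vderive.
Qed.

Lemma drift_smooth : smooth_on I drift.
Proof. apply smooth_curve_dot; auto. now apply smooth_curve_vderive. Qed.

Let P := ruled_patch I J alpha beta.

Lemma patch_vd1 t u : I t ->
  vd1 (pos P) t u = plus (vderive alpha t) (scal u (vderive beta t)).
Proof.
  intro ht. destruct ha as (a1 & a2 & a3), hb as (b1 & b2 & b3).
  assert (key : forall f g, smooth_on I f -> smooth_on I g ->
     Derive (fun s => f s + u * g s) t = Derive f t + u * Derive g t).
  { intros f g hf hg. rewrite Derive_plus.
    - now rewrite Derive_scal.
    - now apply (smooth_on_ex I).
    - apply ex_derive_scal. now apply (smooth_on_ex I). }
  apply R3_eq; [exact (key _ _ a1 b1) | exact (key _ _ a2 b2) | exact (key _ _ a3 b3)].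
Qed.

Lemma patch_vd2 t u : vd2 (pos P) t u = beta t.
Proof.
  assert (key : forall x y, Derive (fun v => x + v * y) u = y).
  { intros x y. apply is_derive_unique. auto_derive; auto. ring. }
  apply R3_eq; exact (key _ _).
Qed.

Lemma patch_vd21 t u : I t -> vd2 (vd1 (pos P)) t u = vderive beta t.
Proof.
  intro ht.
  assert (key : forall c : R3 -> R,
     (forall v, c (vd1 (pos P) t v) = c (vderive alpha t) + v * c (vderive beta t)) ->
     Derive (fun v => c (vd1 (pos P) t v)) u = c (vderive beta t)).
  { intros c h. rewrite (Derive_ext _ _ _ h).
    apply is_derive_unique. auto_derive; auto. ring. }
  apply R3_eq; apply key; intro v; rewrite patch_vd1 by assumption; reflexivity.
Qed.

Lemma patch_vd22 t u : vd2 (vd2 (pos P)) t u = zero.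
Proof.
  assert (key : forall c : R3 -> R, Derive (fun v => c (vd2 (pos P) t v)) u = 0).
  { intros c. rewrite (Derive_ext _ (fun _ => c (beta t))).
    - apply Derive_const.
    - intro v. now rewrite patch_vd2. }
  apply R3_eq; apply key.
Qed.

Lemma patch_fE t u : I t -> fE P t u = distribution t ^ 2 + drift t ^ 2 + u ^ 2.
Proof.
  intro ht. unfold fE. rewrite patch_vd1, <- alpha'_norm2 by assumption.
  assert (h1 := alpha'_beta' t ht). assert (h2 := beta'_unit t ht).
  transitivity (dot (vderive alpha t) (vderive alpha t)
     + 2 * u * dot (vderive alpha t) (vderive beta t)
     + u ^ 2 * dot (vderive beta t) (vderive beta t)).
  - coords. ring.
  - rewrite h1, h2. ring.
Qed.

Lemma patch_fF t u : I t -> fF P t u = drift t.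
Proof.
  intro ht. unfold fF. rewrite patch_vd1, patch_vd2 by assumption.
  assert (h1 := beta_beta' t ht).
  transitivity (drift t + u * dot (beta t) (vderive beta t)).
  - unfold drift. coords. ring.
  - rewrite h1. ring.
Qed.

Lemma patch_fG t u : I t -> fG P t u = 1.
Proof.
  intro ht. unfold fG. rewrite patch_vd2. now apply beta_unit.
Qed.

Lemma patch_detg t u : I t -> detg P t u = distribution t ^ 2 + u ^ 2.
Proof.
  intro ht. unfold detg. rewrite patch_fE, patch_fF, patch_fG by assumption. ring.
Qed.

(** The second derivative in [u] vanishes, so only the mixed coefficient
[beta' . (X1 ^ X2) = lambda] survives. *)
Lemma patch_curvature_form t u : I t -> curvature_form P t u = - distribution t ^ 2.
Proof.
  intro ht. unfold curvature_form. cbv zeta.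
  rewrite patch_vd21, patch_vd22, patch_vd1, patch_vd2 by assumption.
  transitivity (- distribution t ^ 2
     + 0 * dot (vd1 (vd1 (pos P)) t u) zero); [|ring].
  unfold distribution. coords. ring.
Qed.

Lemma patch_smooth : smooth2_map (dom P) (pos P).
Proof.
  assert (hD := box_open I J hI hJ).
  destruct ha as (a1 & a2 & a3), hb as (b1 & b2 & b3).
  assert (lift := fun f => smooth_on_smooth2 I (dom P) hD f (fun s t h => proj1 h)).
  apply lift in a1, a2, a3, b1, b2, b3.
  assert (hu : smooth2_on (dom P) (fun _ u => u)).
  { exact (smooth2_snd (dom P) hD). }
  split; [|split];
    [apply (smooth2_plus (dom P) hD _ (fun t u => u * px (beta t)))
    |apply (smooth2_plus (dom P) hD _ (fun t u => u * py (beta t)))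
    |apply (smooth2_plus (dom P) hD _ (fun t u => u * pz (beta t)))];
    smooth2 hD.
Qed.

Lemma patch_immersed : (forall t, I t -> distribution t <> 0) -> immersed P.
Proof.
  intro h0. split; [|split].
  - exact (box_open I J hI hJ).
  - exact patch_smooth.
  - intros t u [ht hu] x y.
    assert (hg := patch_detg t u ht). unfold detg, fE, fF, fG in hg.
    rewrite <- dot_cross_self in hg.
    assert (h0' := h0 t ht).
    set (v := vd1 (pos P) t u) in *.
    assert (hw : dot (vd2 (pos P) t u) (vd2 (pos P) t u) = 1)
      by exact (patch_fG t u ht).
    set (w := vd2 (pos P) t u) in *. intro hxy.
    assert (hx : x ^ 2 * dot (cross v w) (cross v w) = 0).
    { transitivity (dot (cross (plus (scal x v) (scal y w)) w)
                        (cross (plus (scal x v) (scal y w)) w)).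
      - coords. ring.
      - rewrite hxy. coords. ring. }
    assert (hx0 : x = 0).
    { rewrite hg in hx. assert (0 < distribution t ^ 2) by nra.
      assert (x ^ 2 = 0) by nra. nra. }
    split; [exact hx0|]. subst x.
    assert (hy : y ^ 2 * dot w w = 0).
    { transitivity (dot (plus (scal 0 v) (scal y w)) (plus (scal 0 v) (scal y w))).
      - coords. ring.
      - rewrite hxy. coords. ring. }
    rewrite hw in hy. nra.
Qed.
End RuledPatch.

(** * The Ricci condition on a ruled patch *)

(** The Ricci expression of a ruled patch times [(a + u^2)^7], where [a] is the
square of the distribution parameter with derivatives [a1] and [a2], and [m] is
the drift with derivative [m1]. *)
Definition ricci_polynomial (a a1 a2 m m1 u : R) : R :=
  (a2 * a - a1 ^ 2) * (u ^ 4 - a ^ 2) - a * a1 ^ 2 * (u ^ 2 + a)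
  - 3 / 2 * a * a1 ^ 2 * (u ^ 2 - a)
  + a ^ 2 * (4 * m1 * u * (u ^ 2 + a) - 6 * m * a1 * u - 4 * m ^ 2 * (a - 2 * u ^ 2))
  - m * a * a1 * u * (5 * a - u ^ 2).

Section PatchRicci.
Variables I J : R -> Prop.
Variables alpha beta : R -> R3.
Hypothesis hI : open_interval I.
Hypothesis hJ : open_interval J.
Hypothesis ha : smooth_curve I alpha.
Hypothesis hb : smooth_curve I beta.
Hypothesis hn : forall t, I t ->
     vnorm (beta t) = 1 /\ vnorm (vderive beta t) = 1 /\
     dot (vderive alpha t) (vderive beta t) = 0.
Let P := ruled_patch I J alpha beta.
Hypothesis hP : immersed P.

Let hD : planar_open (dom P) := box_open I J hI hJ.

(** The square of the distribution parameter.  Curvature and metric depend on it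
rationally, and it remains a convenient unknown where [lambda] vanishes, unlike
the logarithm that would simplify the Ricci condition elsewhere. *)
Definition distribution2 t := distribution alpha beta t ^ 2.
Let a := distribution2.
Let m := drift alpha beta.

Lemma distribution2_smooth : smooth_on I distribution2.
Proof.
  assert (hIo := open_interval_open I hI).
  apply (smooth2_smooth_on I hIo). apply (smooth2_pow _ (strip_open I hIo)).
  apply (smooth_on_smooth2 I _ (strip_open I hIo)); auto.
  now apply distribution_smooth.
Qed.

Lemma patch_delta_pos t u : dom P t u -> 0 < a t + u ^ 2.
Proof.
  intro h. unfold a, distribution2.
  rewrite <- (patch_detg I J alpha beta hI ha hb hn t u) by apply h.
  now apply detg_pos.
Qed.

Lemma patch_gauss_curvature :
  agree (dom P) (gauss_curvature P) (fun t u => - a t / (a t + u ^ 2) ^ 2).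
Proof.
  intros t u h. rewrite gauss_curvature_eq by assumption.
  unfold P. rewrite (patch_detg I), (patch_curvature_form I) by (assumption || apply h).
  reflexivity.
Qed.

Lemma drift_ex t : I t -> ex_derive m t.
Proof. intro ht. exact (smooth_on_ex _ _ t (drift_smooth _ _ _ hI ha hb) ht). Qed.

Lemma distribution2_ex t : I t -> ex_derive a t.
Proof. intro ht. exact (smooth_on_ex _ _ t distribution2_smooth ht). Qed.

Lemma distribution2_ex2 t : I t -> ex_derive (Derive a) t.
Proof.
  intro ht.
  exact (smooth_on_ex _ _ t (smooth_on_Derive _ _ distribution2_smooth) ht).
Qed.

Lemma patch_K1 : agree (dom P) (d1 (gauss_curvature P))
  (fun t u => Derive a t * (a t - u ^ 2) / (a t + u ^ 2) ^ 3).
Proof.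
  intros t u h. rewrite (d1_agree _ hD _ _ patch_gauss_curvature t u h).
  assert (hd := patch_delta_pos t u h). assert (ea := distribution2_ex t (proj1 h)).
  apply is_derive_unique. clearbody a. auto_derive.
  - split; [assumption|]. split; [assumption|]. repeat split. nra.
  - change (fun x => a x) with a. field. lra.
Qed.

Lemma patch_K2 : agree (dom P) (d2 (gauss_curvature P))
  (fun t u => 4 * a t * u / (a t + u ^ 2) ^ 3).
Proof.
  intros t u h. rewrite (d2_agree _ hD _ _ patch_gauss_curvature t u h).
  assert (hd := patch_delta_pos t u h).
  apply is_derive_unique. auto_derive.
  - nra.
  - field. lra.
Qed.

Lemma patch_grad1 : agree (dom P) (grad1 P (gauss_curvature P))
  (fun t u => (Derive a t * (a t - u ^ 2) - 4 * m t * a t * u) / (a t + u ^ 2) ^ 4).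
Proof.
  intros t u h. assert (hd := patch_delta_pos t u h). unfold grad1.
  rewrite patch_K1, patch_K2 by assumption. unfold P.
  rewrite (patch_fG I), (patch_fF I), (patch_detg I) by (assumption || apply h).
  fold (distribution2 t). fold a. fold m. field. lra.
Qed.

Lemma patch_grad2 : agree (dom P) (grad2 P (gauss_curvature P))
  (fun t u => ((a t + m t ^ 2 + u ^ 2) * (4 * a t * u)
               - m t * (Derive a t * (a t - u ^ 2))) / (a t + u ^ 2) ^ 4).
Proof.
  intros t u h. assert (hd := patch_delta_pos t u h). unfold grad2.
  rewrite patch_K1, patch_K2 by assumption. unfold P.
  rewrite (patch_fE I), (patch_fF I), (patch_detg I) by (assumption || apply h).
  fold (distribution2 t). fold a. fold m. field. lra.
Qed.

Lemma patch_detg1 t u : dom P t u -> d1 (detg P) t u = Derive a t.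
Proof.
  intro h. rewrite (d1_agree _ hD _ (fun t u => a t + u ^ 2)).
  - assert (ea := distribution2_ex t (proj1 h)).
    apply is_derive_unique. clearbody a. auto_derive; [assumption|].
    change (fun x => a x) with a. ring.
  - intros x y hxy. unfold P. now rewrite (patch_detg I) by (assumption || apply hxy).
  - exact h.
Qed.

Lemma patch_detg2 t u : dom P t u -> d2 (detg P) t u = 2 * u.
Proof.
  intro h. rewrite (d2_agree _ hD _ (fun t u => a t + u ^ 2)).
  - apply is_derive_unique. auto_derive; [exact Logic.I|]. ring.
  - intros x y hxy. unfold P. now rewrite (patch_detg I) by (assumption || apply hxy).
  - exact h.
Qed.

Lemma patch_laplacian t u : dom P t u ->
  d1 (grad1 P (gauss_curvature P)) t u =
  ((Derive (Derive a) t * (a t - u ^ 2) + Derive a t ^ 2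
     - 4 * Derive m t * a t * u - 4 * m t * Derive a t * u) * (a t + u ^ 2)
   - 4 * Derive a t * (Derive a t * (a t - u ^ 2) - 4 * m t * a t * u))
  / (a t + u ^ 2) ^ 5 /\
  d2 (grad2 P (gauss_curvature P)) t u =
  ((8 * a t * u ^ 2 + 4 * a t * (a t + m t ^ 2 + u ^ 2)
     + 2 * m t * Derive a t * u) * (a t + u ^ 2)
   - 8 * u * ((a t + m t ^ 2 + u ^ 2) * (4 * a t * u)
               - m t * (Derive a t * (a t - u ^ 2))))
  / (a t + u ^ 2) ^ 5.
Proof.
  intro h. assert (hd := patch_delta_pos t u h).
  assert (ea := distribution2_ex t (proj1 h)).
  assert (ea2 := distribution2_ex2 t (proj1 h)).
  assert (em := drift_ex t (proj1 h)).
  rewrite (d1_agree _ hD _ _ patch_grad1 t u h), (d2_agree _ hD _ _ patch_grad2 t u h).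
  split; apply is_derive_unique; clearbody a m.
  - set (b := Derive a) in *. assert (hb' : b = Derive a) by reflexivity.
    clearbody b. auto_derive.
    + repeat split; auto. exact (pow_nonzero _ 4 (Rgt_not_eq _ _ hd)).
    + replace (Derive (fun x => a x) t) with (b t) by (now rewrite hb').
      change (fun x => m x) with m. change (fun x => b x) with b. field. lra.
  - auto_derive.
    + repeat split; auto. exact (pow_nonzero _ 4 (Rgt_not_eq _ _ hd)).
    + field. lra.
Qed.

(** The terms free of [a'], [a''], [m] and [m'] are those of a helicoid and cancel:
every monomial of the polynomial contains one of these four quantities. *)
Lemma patch_ricci t u : dom P t u ->
  let K := gauss_curvature P in
  K t u * laplacian P K t u - metric_norm2 P (grad1 P K) (grad2 P K) t u
      - 4 * K t u ^ 3 =
  ricci_polynomial (a t) (Derive a t) (Derive (Derive a) t) (m t) (Derive m t) u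
  / (a t + u ^ 2) ^ 7.
Proof.
  intros h K. assert (hd := patch_delta_pos t u h).
  unfold laplacian. rewrite divergence_eq; auto.
  2: now apply grad1_smooth, gauss_curvature_smooth.
  2: now apply grad2_smooth, gauss_curvature_smooth.
  destruct (patch_laplacian t u h) as [e1 e2].
  unfold K. rewrite e1, e2. unfold metric_norm2.
  rewrite patch_detg1, patch_detg2, patch_grad1, patch_grad2, patch_gauss_curvature
    by assumption.
  unfold P.
  rewrite (patch_fE I), (patch_fF I), (patch_fG I), (patch_detg I)
    by (assumption || apply h).
  fold (distribution2 t). fold a. fold m. unfold ricci_polynomial. field. lra.
Qed.
End PatchRicci.

(** * Rigidity of the distribution parameter *)

(** Five equally spaced points of [J] suffice: the finite difference of order [k]
isolates [k! c_k d^k] once the higher coefficients are known to vanish. *)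
Lemma quartic_vanishing J c0 c1 c2 c3 c4 :
  open_interval J ->
  (forall u, J u -> c0 + c1 * u + c2 * u ^ 2 + c3 * u ^ 3 + c4 * u ^ 4 = 0) ->
  c0 = 0 /\ c1 = 0 /\ c2 = 0 /\ c3 = 0 /\ c4 = 0.
Proof.
  intros hJ h. destruct (open_interval_inhabited J hJ) as [x hx].
  destruct (open_interval_open J hJ x hx) as [e he].
  assert (ep := cond_pos e).
  set (d := e / 8) in *. assert (dp : 0 < d) by (unfold d; lra).
  assert (hk : forall k, 0 <= k <= 4 -> J (x + k * d)).
  { intros k hk. apply he.
    change (Rabs (x + k * d - x) < e).
    replace (x + k * d - x) with (k * d) by ring.
    rewrite Rabs_pos_eq by nra. unfold d. nra. }
  assert (p0 := h _ (hk 0 ltac:(lra))). assert (p1 := h _ (hk 1 ltac:(lra))).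
  assert (p2 := h _ (hk 2 ltac:(lra))). assert (p3 := h _ (hk 3 ltac:(lra))).
  assert (p4 := h _ (hk 4 ltac:(lra))).
  clearbody d. clear h hk he.
  assert (z4 : c4 = 0).
  { assert (0 < d ^ 4) by (apply pow_lt; lra).
    apply (Rmult_eq_reg_r (24 * d ^ 4)); [ring_simplify; nra | lra]. }
  subst c4.
  assert (z3 : c3 = 0).
  { assert (0 < d ^ 3) by (apply pow_lt; lra).
    apply (Rmult_eq_reg_r (6 * d ^ 3)); [ring_simplify; nra | lra]. }
  subst c3.
  assert (z2 : c2 = 0).
  { assert (0 < d ^ 2) by (apply pow_lt; lra).
    apply (Rmult_eq_reg_r (2 * d ^ 2)); [ring_simplify; nra | lra]. }
  subst c2.
  assert (z1 : c1 = 0).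
  { apply (Rmult_eq_reg_r d); [|lra]. ring_simplify. nra. }
  subst c1. repeat split; lra.
Qed.

(** Eliminating the leading coefficient from the constant one gives
[a1^2 = 8 a m^2], whereas the coefficient of [u^2] gives
[5 a1^2 = 16 a m^2]; the two agree only for [m = 0]. *)
Lemma ricci_polynomial_rigid J a a1 a2 m m1 :
  open_interval J -> 0 < a ->
  (forall u, J u -> ricci_polynomial a a1 a2 m m1 u = 0) -> a1 = 0 /\ m = 0.
Proof.
  intros hJ hp h.
  destruct (quartic_vanishing J
    (- (a2 * a - a1 ^ 2) * a ^ 2 - a ^ 2 * a1 ^ 2 + 3 / 2 * a ^ 2 * a1 ^ 2
       - 4 * a ^ 3 * m ^ 2)
    (4 * a ^ 3 * m1 - 6 * a ^ 2 * m * a1 - 5 * m * a ^ 2 * a1)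
    (- (5 / 2) * a * a1 ^ 2 + 8 * a ^ 2 * m ^ 2)
    (4 * a ^ 2 * m1 + m * a * a1) (a2 * a - a1 ^ 2) hJ) as (h0 & _ & h2 & _ & h4).
  { intros u hu. rewrite <- (h u hu). unfold ricci_polynomial. field. }
  assert (k0 : a ^ 2 * (a1 ^ 2 - 8 * a * m ^ 2) = 0).
  { transitivity (2 * ((- (a2 * a - a1 ^ 2) * a ^ 2 - a ^ 2 * a1 ^ 2
       + 3 / 2 * a ^ 2 * a1 ^ 2 - 4 * a ^ 3 * m ^ 2)
       + a ^ 2 * (a2 * a - a1 ^ 2))); [field|]. rewrite h0, h4. ring. }
  assert (k1 : a1 ^ 2 = 8 * a * m ^ 2).
  { apply Rmult_integral in k0. destruct k0; nra. }
  assert (k2 : m = 0).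
  { assert (12 * a ^ 2 * m ^ 2 = 0).
    { transitivity (- (- (5 / 2) * a * (8 * a * m ^ 2) + 8 * a ^ 2 * m ^ 2)); [field|].
      rewrite <- k1, h2. ring. }
    assert (0 < 12 * a ^ 2) by nra.
    assert (m ^ 2 = 0) by nra. nra. }
  split; [|exact k2]. rewrite k2 in k1. nra.
Qed.

Section RicciRigidity.
Variables I J : R -> Prop.
Variables alpha beta : R -> R3.
Hypothesis hI : open_interval I.
Hypothesis hJ : open_interval J.
Hypothesis ha : smooth_curve I alpha.
Hypothesis hb : smooth_curve I beta.
Hypothesis hn : forall t, I t ->
     vnorm (beta t) = 1 /\ vnorm (vderive beta t) = 1 /\
     dot (vderive alpha t) (vderive beta t) = 0.
Let P := ruled_patch I J alpha beta.
Hypothesis hP : immersed P.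
Hypothesis hR : ricci_condition P.
Let L := distribution alpha beta.

Lemma ricci_pointwise t : I t -> L t <> 0 ->
  Derive (distribution2 alpha beta) t = 0 /\ drift alpha beta t = 0.
Proof.
  intros ht hL. assert (h0 : 0 < distribution2 alpha beta t).
  { unfold distribution2. fold L. nra. }
  apply (ricci_polynomial_rigid J (distribution2 alpha beta t) _
    (Derive (Derive (distribution2 alpha beta)) t) _ (Derive (drift alpha beta) t) hJ h0).
  intros u hu.
  assert (h := patch_ricci I J alpha beta hI hJ ha hb hn hP t u (conj ht hu)).
  assert (h' := hR t u (conj ht hu)). unfold P in h'. cbv zeta in h, h'.
  rewrite h' in h.
  assert (hd : (distribution2 alpha beta t + u ^ 2) ^ 7 <> 0)
    by (apply pow_nonzero; nra).
  symmetry in h. apply (Rmult_eq_compat_r ((distribution2 alpha beta t + u ^ 2) ^ 7)) in h.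
  rewrite Rmult_0_l in h. rewrite <- h. field. nra.
Qed.

Lemma distribution_Derive t : I t ->
  Derive (distribution2 alpha beta) t = 2 * L t * Derive L t.
Proof.
  intro ht.
  assert (e := smooth_on_ex I L t (distribution_smooth I alpha beta hI ha hb) ht).
  apply is_derive_unique. unfold distribution2. fold L. clearbody L.
  change (is_derive (fun s => L s ^ 2) t (2 * L t * Derive L t)).
  auto_derive; [assumption|]. change (fun x => L x) with L. ring.
Qed.

(** The pointwise conclusion holds only where [lambda <> 0], but it implies that the
derivative [2 lambda lambda'] of [lambda^2] vanishes everywhere.  Hence
[lambda] cannot reach zero if it is nonzero at [t0]. *)
Lemma distribution_constant t0 : I t0 -> L t0 <> 0 ->
  forall t, I t -> L t = L t0 /\ drift alpha beta t = 0.
Proof.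
  intros ht0 h0.
  assert (hIo := open_interval_open I hI).
  assert (hs := distribution_smooth I alpha beta hI ha hb). fold L in hs.
  assert (hz : forall t, I t -> L t * Derive L t = 0).
  { intros t ht. destruct (Req_dec (L t) 0) as [e | e]; [rewrite e; ring|].
    destruct (ricci_pointwise t ht e) as [h _].
    rewrite distribution_Derive in h by assumption. lra. }
  assert (h2 : forall s t, I s -> I t -> L s ^ 2 = L t ^ 2).
  { apply (constant_of_Derive I (fun t => L t ^ 2) hI).
    - apply (smooth2_smooth_on I hIo), (smooth2_pow _ (strip_open I hIo)).
      apply (smooth_on_smooth2 I _ (strip_open I hIo)); auto.
    - intros t ht. change (Derive (distribution2 alpha beta) t = 0).
      rewrite distribution_Derive by assumption. rewrite Rmult_assoc, hz by assumption.
      ring. }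
  assert (hne : forall t, I t -> L t <> 0).
  { intros t ht e. specialize (h2 t t0 ht ht0). rewrite e in h2. nra. }
  intros t ht. split.
  - apply (constant_of_Derive I L hI hs); auto.
    intros s hs'. specialize (hz s hs'). specialize (hne s hs').
    apply Rmult_integral in hz. tauto.
  - now apply ricci_pointwise; [|apply hne].
Qed.
End RicciRigidity.

(** Non-vanishing of the distribution parameter is thus a property of the curvature,
which does not depend on the ruled parametrization chosen. *)
Lemma patch_curvature_neq0 I J alpha beta t u :
  open_interval I -> open_interval J -> smooth_curve I alpha -> smooth_curve I beta ->
  (forall t, I t ->
     vnorm (beta t) = 1 /\ vnorm (vderive beta t) = 1 /\
     dot (vderive alpha t) (vderive beta t) = 0) ->
  immersed (ruled_patch I J alpha beta) -> I t -> J u ->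
  (gauss_curvature (ruled_patch I J alpha beta) t u <> 0 <->
   distribution alpha beta t <> 0).
Proof.
  intros hI hJ ha hb hn hP ht hu.
  assert (h : dom (ruled_patch I J alpha beta) t u) by now split.
  rewrite (patch_gauss_curvature I J alpha beta hI ha hb hn hP t u h).
  assert (hd := patch_delta_pos I J alpha beta hI ha hb hn hP t u h).
  assert (hq : (distribution2 alpha beta t + u ^ 2) ^ 2 <> 0)
    by (apply pow_nonzero; lra).
  unfold distribution2 in *. split; intros h1 h2; apply h1.
  - rewrite h2 at 1. unfold Rdiv. ring.
  - apply (Rmult_eq_compat_r ((distribution alpha beta t ^ 2 + u ^ 2) ^ 2)) in h2.
    unfold Rdiv in h2. rewrite Rmult_assoc, Rinv_l, Rmult_0_l in h2 by assumption.
    nra.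
Qed.

(** * Planar lines of striction *)

Section PlanarStriction.
Variables I : R -> Prop.
Variables alpha beta : R -> R3.
Hypothesis hI : open_interval I.
Hypothesis ha : smooth_curve I alpha.
Hypothesis hb : smooth_curve I beta.
Hypothesis hn : forall t, I t ->
     vnorm (beta t) = 1 /\ vnorm (vderive beta t) = 1 /\
     dot (vderive alpha t) (vderive beta t) = 0.
Variable L : R.
Hypothesis hL0 : L <> 0.
Hypothesis hL : forall t, I t -> distribution alpha beta t = L.
Hypothesis hm : forall t, I t -> drift alpha beta t = 0.

Let hIo := open_interval_open I hI.
Let ha' := smooth_curve_vderive I alpha ha.
Let hb' := smooth_curve_vderive I beta hb.
Let ha'' := smooth_curve_vderive I _ ha'.
Let hb'' := smooth_curve_vderive I _ hb'.
Let B := beta_unit I alpha beta hn.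
Let B' := beta'_unit I alpha beta hn.
Let BB' := beta_beta' I alpha beta hI hb hn.

Lemma alpha'_eq t : I t ->
  vderive alpha t = scal L (cross (beta t) (vderive beta t)).
Proof.
  intro ht.
  assert (h := cross_alpha'_beta I alpha beta hI hb hn t ht).
  rewrite hL in h by assumption.
  (* The expansion of [beta ^ (alpha' ^ beta)], solved for [alpha']. *)
  assert (e : vderive alpha t =
     plus (cross (beta t) (cross (vderive alpha t) (beta t)))
       (plus (scal (1 - dot (beta t) (beta t)) (vderive alpha t))
             (scal (drift alpha beta t) (beta t)))).
  { unfold drift. apply R3_eq; coords; ring. }
  rewrite e, h, B, hm by assumption. apply R3_eq; coords; ring.
Qed.

Lemma beta''_beta t : I t -> dot (vderive (vderive beta) t) (beta t) = -1.
Proof.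
  intro ht. assert (h := Derive_locally_const I hIo _ _ t BB' ht).
  rewrite (Derive_dot I), B' in h by assumption.
  rewrite dot_comm in h. rewrite dot_comm. rewrite dot_comm in h. lra.
Qed.

Lemma beta''_beta' t : I t -> dot (vderive (vderive beta) t) (vderive beta t) = 0.
Proof.
  intro ht. assert (h := Derive_locally_const I hIo _ _ t B' ht).
  rewrite (Derive_dot I) in h by assumption.
  rewrite (dot_comm (vderive beta t)) in h. lra.
Qed.

(** [L] times the geodesic curvature of the spherical curve [beta].  It is defined
through [alpha'], which plays the part of [L (beta ^ beta')], so that only scalar
products have to be differentiated. *)
Definition twist t := dot (vderive alpha t) (vderive (vderive beta) t).

Lemma beta''_eq t : I t ->
  vderive (vderive beta) t =
  plus (scal (-1) (beta t)) (scal (twist t / L) (cross (beta t) (vderive beta t))).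
Proof.
  intro ht.
  rewrite (frame_expansion (vderive (vderive beta) t) (beta t) (vderive beta t)) by auto.
  rewrite beta''_beta, beta''_beta' by assumption.
  replace (twist t / L) with
    (dot (vderive (vderive beta) t) (cross (beta t) (vderive beta t))).
  - apply R3_eq; coords; ring.
  - unfold twist. rewrite alpha'_eq, (dot_comm (scal _ _)), dot_scal_r by assumption. field. exact hL0.
Qed.

(** Differentiating [alpha' . beta = 0], [alpha' . beta' = 0] and
[alpha' . alpha' = L^2] gives the three coordinates of [alpha''] in the frame. *)
Lemma alpha''_eq t : I t ->
  vderive (vderive alpha) t = scal (- twist t) (vderive beta t).
Proof.
  intro ht.
  assert (e1 : dot (vderive (vderive alpha) t) (beta t) = 0).
  { assert (h := Derive_locally_const I hIo _ _ t hm ht). unfold drift in h.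
    rewrite (Derive_dot I) in h by assumption.
    rewrite (alpha'_beta' I alpha beta hn) in h by assumption. lra. }
  assert (e2 : dot (vderive (vderive alpha) t) (vderive beta t) = - twist t).
  { assert (h := Derive_locally_const I hIo _ _ t (alpha'_beta' I alpha beta hn) ht).
    rewrite (Derive_dot I) in h by assumption. unfold twist. lra. }
  assert (e3 : dot (vderive (vderive alpha) t) (vderive alpha t) = 0).
  { assert (h0 : forall s, I s -> dot (vderive alpha s) (vderive alpha s) = L ^ 2).
    { intros s hs. rewrite (alpha'_norm2 I alpha beta hI hb hn) by assumption.
      rewrite hL, hm by assumption. ring. }
    assert (h := Derive_locally_const I hIo _ _ t h0 ht).
    rewrite (Derive_dot I) in h by assumption.
    rewrite (dot_comm (vderive alpha t)) in h. lra. }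
  rewrite alpha'_eq, dot_scal_r in e3 by assumption.
  apply Rmult_integral in e3. destruct e3 as [e3 | e3]; [now elim hL0|].
  rewrite (frame_expansion (vderive (vderive alpha) t) (beta t) (vderive beta t)) by auto.
  rewrite e1, e2, e3. apply R3_eq; coords; ring.
Qed.

Variables (n : R3) (c : R).
Hypothesis n0 : n <> zero.
Hypothesis hplane : forall t, I t -> dot n (alpha t) = c.

Lemma Derive_dot_n d t : smooth_curve I d -> I t ->
  Derive (fun t => dot n (d t)) t = dot n (vderive d t).
Proof.
  intros hd ht. rewrite (Derive_dot I (fun _ => n)) by (auto; apply smooth_curve_const).
  rewrite vderive_const, dot_zero_l. ring.
Qed.

(** Planarity gives [n . alpha' = 0], and then [twist * (n . beta') = 0] by
[alpha''_eq].  At a point where the twist is nonzero the derivative of this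
product vanishes as well, which yields [n . beta'' = 0] and, through
[beta''_eq], [n . beta = 0]: the normal [n] is orthogonal to a frame. *)
Lemma twist_eq0 t : I t -> twist t = 0.
Proof.
  intro ht. destruct (Req_dec (twist t) 0) as [e | e]; [exact e | exfalso].
  assert (h1 : forall s, I s -> dot n (vderive alpha s) = 0).
  { intros s hs. rewrite <- Derive_dot_n by assumption.
    exact (Derive_locally_const I hIo _ _ s hplane hs). }
  assert (h2 : forall s, I s -> twist s * dot n (vderive beta s) = 0).
  { intros s hs.
    assert (h := Derive_locally_const I hIo _ _ s h1 hs).
    rewrite Derive_dot_n, alpha''_eq, dot_scal_r in h by assumption. lra. }
  assert (hk : smooth_on I twist) by (apply smooth_curve_dot; assumption).
  assert (h3 := Derive_locally_const I hIo _ _ t h2 ht).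
  assert (hnb : smooth_on I (fun s => dot n (vderive beta s))).
  { apply (smooth_curve_dot I hIo (fun _ => n)); auto. apply smooth_curve_const. }
  rewrite (Derive_mult twist (fun s => dot n (vderive beta s))) in h3
    by (apply (smooth_on_ex I); assumption).
  rewrite Derive_dot_n in h3 by assumption.
  assert (k1 : dot n (vderive beta t) = 0).
  { specialize (h2 t ht). apply Rmult_integral in h2. tauto. }
  rewrite k1 in h3.
  (* What remains of the product rule is [twist t * (n . beta'' t)]. *)
  assert (k2 : dot n (vderive (vderive beta) t) = 0).
  { assert (z : twist t * dot n (vderive (vderive beta) t) = 0) by lra.
    apply Rmult_integral in z. tauto. }
  assert (k3 : dot n (cross (beta t) (vderive beta t)) = 0).
  { specialize (h1 t ht). rewrite alpha'_eq, dot_scal_r in h1 by assumption.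
    apply Rmult_integral in h1. tauto. }
  assert (k4 : dot n (beta t) = 0).
  { rewrite beta''_eq in k2 by assumption.
    assert (z : dot n (plus (scal (-1) (beta t))
       (scal (twist t / L) (cross (beta t) (vderive beta t))))
       = - dot n (beta t) + twist t / L * dot n (cross (beta t) (vderive beta t)))
      by (generalize (cross (beta t) (vderive beta t)); intro; coords; ring).
    rewrite z, k3 in k2. lra. }
  apply n0. rewrite (frame_expansion n (beta t) (vderive beta t)) by auto.
  rewrite k1, k3, k4. apply R3_eq; coords; ring.
Qed.

Lemma beta_harmonic t : I t -> vderive (vderive beta) t = scal (-1) (beta t).
Proof.
  intro ht. rewrite beta''_eq, twist_eq0 by assumption.
  apply R3_eq; coords; field; exact hL0.
Qed.

Lemma beta_circle : exists e1 e2, forall t, I t ->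
  beta t = plus (scal (cos t) e1) (scal (sin t) e2) /\
  vderive beta t = plus (scal (- sin t) e1) (scal (cos t) e2).
Proof.
  pose proof hb as (b1 & b2 & b3).
  destruct (harmonic_solution I _ hI b1) as (x1 & x2 & hx).
  { intros t ht. transitivity (px (scal (-1) (beta t))).
    - rewrite <- beta_harmonic by assumption. reflexivity.
    - coords. ring. }
  destruct (harmonic_solution I _ hI b2) as (y1 & y2 & hy).
  { intros t ht. transitivity (py (scal (-1) (beta t))).
    - rewrite <- beta_harmonic by assumption. reflexivity.
    - coords. ring. }
  destruct (harmonic_solution I _ hI b3) as (z1 & z2 & hz).
  { intros t ht. transitivity (pz (scal (-1) (beta t))).
    - rewrite <- beta_harmonic by assumption. reflexivity.
    - coords. ring. }
  exists (x1, y1, z1), (x2, y2, z2). intros t ht. split; apply R3_eq.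
  - exact (proj1 (hx t ht)).
  - exact (proj1 (hy t ht)).
  - exact (proj1 (hz t ht)).
  - exact (proj2 (hx t ht)).
  - exact (proj2 (hy t ht)).
  - exact (proj2 (hz t ht)).
Qed.

(** With [beta t = cos t e1 + sin t e2] the vector [beta ^ beta'] is the constant
[e1 ^ e2], so [alpha] moves uniformly along this direction and the patch is the
image of the helicoid in the frame [(e1, e2, e1 ^ e2)], with the same
coordinates. *)
Lemma planar_striction_helicoid : exists m, isometry m /\
  forall t u, I t ->
    plus (alpha t) (scal u (beta t)) = m (helicoid L 0 t u).
Proof.
  destruct beta_circle as (e1 & e2 & he).
  set (e3 := cross e1 e2).
  assert (h3 : forall t, I t -> vderive alpha t = scal L e3).
  { intros t ht. rewrite alpha'_eq by assumption. destruct (he t ht) as [-> ->].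
    assert (e := sin2_cos2 t). unfold Rsqr in e.
    transitivity (scal (L * (sin t * sin t + cos t * cos t)) e3).
    - unfold e3. apply R3_eq; coords; ring.
    - rewrite e. now rewrite Rmult_1_r. }
  assert (ho : orthonormal e1 e2 e3).
  { destruct (open_interval_inhabited I hI) as [t ht].
    destruct (he t ht) as [hb1 hb2]. assert (e := sin2_cos2 t). unfold Rsqr in e.
    (* The rotation by [- t] recovers the constant vectors from [beta] and [beta']. *)
    assert (f1 : e1 = plus (scal (cos t) (beta t)) (scal (- sin t) (vderive beta t))).
    { transitivity (scal (sin t * sin t + cos t * cos t) e1).
      - rewrite e. apply R3_eq; coords; ring.
      - rewrite hb1, hb2. apply R3_eq; coords; ring. }
    assert (f2 : e2 = plus (scal (sin t) (beta t)) (scal (cos t) (vderive beta t))).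
    { transitivity (scal (sin t * sin t + cos t * cos t) e2).
      - rewrite e. apply R3_eq; coords; ring.
      - rewrite hb1, hb2. apply R3_eq; coords; ring. }
    assert (k1 := B t ht). assert (k2 := B' t ht). assert (k3 := BB' t ht).
    assert (ex : forall x y x' y',
      dot (plus (scal x (beta t)) (scal y (vderive beta t)))
          (plus (scal x' (beta t)) (scal y' (vderive beta t))) = x * x' + y * y').
    { intros. transitivity (x * x' * dot (beta t) (beta t)
        + (x * y' + x' * y) * dot (beta t) (vderive beta t)
        + y * y' * dot (vderive beta t) (vderive beta t)).
      - coords. ring.
      - rewrite k1, k2, k3. ring. }
    assert (o1 : dot e1 e1 = 1) by (rewrite f1, ex; lra).
    assert (o2 : dot e2 e2 = 1) by (rewrite f2, ex; lra).
    assert (o12 : dot e1 e2 = 0) by (rewrite f1, f2, ex; lra).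
    repeat split; auto.
    - unfold e3. rewrite dot_cross_self, o1, o2, o12. ring.
    - unfold e3. coords. ring.
    - unfold e3. coords. ring. }
  pose proof ha as (a1 & a2 & a3).
  destruct (affine_solution I _ (px (scal L e3)) hI a1) as [x hx].
  { intros t ht. rewrite <- (h3 t ht). reflexivity. }
  destruct (affine_solution I _ (py (scal L e3)) hI a2) as [y hy].
  { intros t ht. rewrite <- (h3 t ht). reflexivity. }
  destruct (affine_solution I _ (pz (scal L e3)) hI a3) as [z hz].
  { intros t ht. rewrite <- (h3 t ht). reflexivity. }
  exists (frame_map (x, y, z) e1 e2 e3). split; [now apply frame_map_isometry|].
  intros t u ht. rewrite (proj1 (he t ht)).
  assert (ea : alpha t = plus (x, y, z) (scal t (scal L e3))).
  { apply R3_eq; [exact (hx t ht) | exact (hy t ht) | exact (hz t ht)]. }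
  rewrite ea. unfold frame_map, helicoid. generalize e3, (cos t), (sin t). intros.
  apply R3_eq; coords; ring.
Qed.
End PlanarStriction.

(** * Helicoids are Ricci ruled surfaces *)

Section HelicoidPatch.
Variables I J : R -> Prop.
Hypothesis hI : open_interval I.
Hypothesis hJ : open_interval J.
Variables a b : R.
Hypothesis a0 : a <> 0.
Variables o e1 e2 e3 : R3.
Hypothesis he : orthonormal e1 e2 e3.

(** The helicoid in a general frame, written as a ruled patch: [axis] is its line of
striction and [ruling] its spherical curve. *)
Definition axis (t : R) : R3 := plus (plus o (scal b e3)) (scal t (scal a e3)).
Definition ruling (t : R) : R3 := plus (scal (cos t) e1) (scal (sin t) e2).

Lemma helicoid_ruled t u :
  frame_map o e1 e2 e3 (helicoid a b t u) = plus (axis t) (scal u (ruling t)).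
Proof.
  unfold frame_map, helicoid, axis, ruling. generalize (cos t), (sin t). intros.
  apply R3_eq; coords; ring.
Qed.

Lemma axis_smooth : smooth_curve I axis.
Proof.
  assert (h : forall x y, smooth_on I (fun t => x + t * y)).
  { intros x y n t ht. apply (ex_derive_n_ext (fun t => x + y * t)).
    - intro s. ring.
    - now apply smooth_on_affine with (I := I). }
  split; [|split]; apply h.
Qed.

Lemma ruling_smooth : smooth_curve I ruling.
Proof.
  assert (h : forall x y, smooth_on I (fun t => cos t * x + sin t * y)).
  { intros x y n t ht. apply (ex_derive_n_ext (fun t => x * cos t + y * sin t)).
    - intro s. ring.
    - now apply smooth_on_trig with (I := I). }
  split; [|split]; apply h.
Qed.

Lemma axis_vderive t : vderive axis t = scal a e3.
Proof.
  assert (h : forall x y, Derive (fun t => x + t * y) t = y).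
  { intros x y. apply is_derive_unique. auto_derive; [exact Logic.I|]. ring. }
  apply R3_eq; apply h.
Qed.

Lemma ruling_vderive t : vderive ruling t = plus (scal (- sin t) e1) (scal (cos t) e2).
Proof.
  assert (h : forall x y, Derive (fun t => cos t * x + sin t * y) t
                          = - sin t * x + cos t * y).
  { intros x y. apply is_derive_unique. auto_derive; [exact Logic.I|]. ring. }
  apply R3_eq; apply h.
Qed.

Lemma combination_dot x y x' y' :
  dot (plus (scal x e1) (scal y e2)) (plus (scal x' e1) (scal y' e2))
  = x * x' + y * y'.
Proof.
  destruct he as (h1 & h2 & h3 & h4 & h5 & h6).
  transitivity (x * x' * dot e1 e1 + (x * y' + x' * y) * dot e1 e2
                + y * y' * dot e2 e2).
  - coords. ring.
  - rewrite h1, h2, h4. ring.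
Qed.

Lemma combination_dot3 c x y :
  dot (scal c e3) (plus (scal x e1) (scal y e2)) = 0.
Proof.
  destruct he as (h1 & h2 & h3 & h4 & h5 & h6).
  transitivity (c * (x * dot e1 e3 + y * dot e2 e3)).
  - coords. ring.
  - rewrite h5, h6. ring.
Qed.

Lemma helicoid_striction t :
  vnorm (ruling t) = 1 /\ vnorm (vderive ruling t) = 1 /\
  dot (vderive axis t) (vderive ruling t) = 0.
Proof.
  assert (e := sin2_cos2 t). unfold Rsqr in e.
  rewrite ruling_vderive, axis_vderive. unfold vnorm, ruling. split; [|split].
  - rewrite combination_dot, <- sqrt_1. f_equal. lra.
  - rewrite combination_dot, <- sqrt_1. f_equal. lra.
  - exact (combination_dot3 a (- sin t) (cos t)).
Qed.

Let hs : forall t, I t -> _ := fun t _ => helicoid_striction t.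

Lemma helicoid_drift t : drift axis ruling t = 0.
Proof. unfold drift. rewrite axis_vderive. exact (combination_dot3 a (cos t) (sin t)). Qed.

(** Only the square is determined: the sign of the distribution parameter depends on
the orientation of the frame. *)
Lemma helicoid_distribution2 t : I t -> distribution axis ruling t ^ 2 = a ^ 2.
Proof.
  intro ht.
  assert (h := alpha'_norm2 I axis ruling hI ruling_smooth hs t ht).
  rewrite helicoid_drift, axis_vderive, dot_scal_r, dot_comm, dot_scal_r in h.
  destruct he as (h1 & h2 & h3 & h4 & h5 & h6). rewrite h3 in h. lra.
Qed.

Lemma helicoid_distribution_neq0 t : I t -> distribution axis ruling t <> 0.
Proof.
  intros ht h. assert (h' := helicoid_distribution2 t ht). rewrite h in h'.
  assert (0 < a ^ 2) by nra. nra.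
Qed.

Lemma helicoid_immersed : immersed (ruled_patch I J axis ruling).
Proof.
  apply patch_immersed; auto using axis_smooth, ruling_smooth.
  exact helicoid_distribution_neq0.
Qed.

Lemma helicoid_ricci : ricci_condition (ruled_patch I J axis ruling).
Proof.
  intros t u h. cbv zeta.
  rewrite (patch_ricci I J axis ruling hI hJ axis_smooth ruling_smooth hs
             helicoid_immersed t u h).
  assert (hIo := open_interval_open I hI).
  assert (k1 : forall s, I s -> Derive (distribution2 axis ruling) s = 0).
  { intros s ks. apply (Derive_locally_const I hIo _ (a ^ 2)); auto.
    exact helicoid_distribution2. }
  assert (k2 : Derive (Derive (distribution2 axis ruling)) t = 0)
    by (apply (Derive_locally_const I hIo _ 0); auto; apply h).
  assert (k3 : Derive (drift axis ruling) t = 0).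
  { apply (Derive_locally_const I hIo _ 0); [intros; apply helicoid_drift | apply h]. }
  rewrite k1, k2, k3, helicoid_drift by apply h.
  unfold ricci_polynomial, Rdiv. ring.
Qed.
End HelicoidPatch.

Lemma same_surface_pos_eq D X Y S :
  (forall s t, D s t -> X s t = Y s t) ->
  same_surface (Surface D X) S -> same_surface (Surface D Y) S.
Proof.
  intros h (p & q & hd & hpos). exists p, q. split; [exact hd|].
  intros s t hst. rewrite <- hpos by exact hst. symmetry. exact (h s t hst).
Qed.

Lemma helicoid_piece_ruled S : helicoid_piece S ->
  exists I J alpha beta, ruled_parametrization S I J alpha beta /\
    (forall t, I t -> distribution alpha beta t <> 0) /\
    ricci_condition (ruled_patch I J alpha beta) /\
    in_affine_plane (fun v => exists t, I t /\ v = alpha t).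
Proof.
  intros (I & J & a & b & m & hI & hJ & a0 & hm & hS).
  destruct (isometry_frame_map m hm) as (o & e1 & e2 & e3 & he & hme).
  exists I, J, (axis a b o e3), (ruling e1 e2).
  split; [|split; [|split]].
  - split; [exact hI|]. split; [exact hJ|].
    split; [apply axis_smooth|]. split; [apply ruling_smooth|].
    split; [intros t _; now apply helicoid_striction|].
    split; [now apply helicoid_immersed|].
    apply (same_surface_pos_eq _ (fun t u => m (helicoid a b t u))); [|exact hS].
    intros t u _. rewrite hme. apply helicoid_ruled.
  - now apply helicoid_distribution_neq0.
  - now apply helicoid_ricci.
  - exists e1, (dot e1 o). destruct he as (h1 & h2 & h3 & h4 & h5 & h6). split.
    + intro e. rewrite e in h1. revert h1. coords. lra.
    + intros v (t & _ & ->).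
      transitivity (dot e1 o + (b + t * a) * dot e1 e3).
      * unfold axis. coords. ring.
      * rewrite h5. ring.
Qed.

Lemma distribution_parameter_eq S I J alpha beta lambda t :
  ruled_parametrization S I J alpha beta ->
  distribution_parameter I alpha beta lambda -> I t ->
  distribution alpha beta t = lambda t.
Proof.
  intros (hI & hJ & ha & hb & hn & hP & hs) hl ht.
  unfold distribution. rewrite hl by exact ht.
  rewrite dot_comm, dot_scal_r, (beta'_unit I alpha beta hn) by exact ht. ring.
Qed.

Lemma ruled_distribution_parameter S I J alpha beta :
  ruled_parametrization S I J alpha beta ->
  distribution_parameter I alpha beta (distribution alpha beta).
Proof.
  intros (hI & hJ & ha & hb & hn & hP & hs) t ht.
  now apply (cross_alpha'_beta I).
Qed.

(** The parametrization that witnesses non-developability need not be the given one.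
A point where its distribution parameter is nonzero has nonzero curvature; the
same point of the surface, read in the given parametrization, has the same
curvature. *)
Lemma non_developable_distribution S I J alpha beta :
  immersed S -> non_developable S -> ruled_parametrization S I J alpha beta ->
  exists t, I t /\ distribution alpha beta t <> 0.
Proof.
  intros hS (I0 & J0 & al & be & la & h0 & hl & hne) h.
  apply Classical_Prop.NNPP. intro hno. apply hne. intros t ht.
  assert (hd := distribution_parameter_eq _ _ _ _ _ _ t h0 hl ht).
  destruct h0 as (hI0 & hJ0 & ha0 & hb0 & hn0 & hP0 & hs0).
  destruct h as (hI & hJ & ha & hb & hn & hP & hs).
  destruct (open_interval_inhabited J0 hJ0) as [u hu].
  destruct (same_surface_curvature _ _ t u hS hP0 hs0 (conj ht hu)) as (s1 & s2 & hs12 & e1).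
  destruct (same_surface_curvature _ _ s1 s2 hP hS (same_surface_sym _ _ hs) hs12)
    as (t' & u' & [ht' hu'] & e2).
  rewrite <- hd. apply Classical_Prop.NNPP. intro hz. apply hno. exists t'.
  split; [exact ht'|].
  apply (patch_curvature_neq0 I J alpha beta t' u'); auto.
  rewrite <- e2, <- e1. now apply patch_curvature_neq0.
Qed.

Theorem corollary2 (S : surface) (hS : immersed S) :
  (ruled_ricci_surface S -> non_developable S ->
     (planar_striction_parametrization S <-> helicoid_piece S)) /\
  (helicoid_piece S -> ruled_ricci_surface S /\ non_developable S).
Proof.
  split.
  - intros [_ hR] hnd. split.
    + intros (I & J & alpha & beta & h & n & c & n0 & hn).
      destruct (non_developable_distribution S I J alpha beta hS hnd h) as (t0 & ht0 & hL).
      destruct h as (hI & hJ & ha & hb & hc & hP & hs).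
      assert (hRP := same_surface_ricci _ _ hS hP hs hR).
      assert (hcst := distribution_constant I J alpha beta hI hJ ha hb hc hP hRP t0 ht0 hL).
      destruct (planar_striction_helicoid I alpha beta hI ha hb hc
        (distribution alpha beta t0) hL (fun t ht => proj1 (hcst t ht))
        (fun t ht => proj2 (hcst t ht)) n c n0) as (m & hm & e).
      { intros t ht. apply hn. now exists t. }
      exists I, J, (distribution alpha beta t0), 0, m.
      repeat (split; [assumption|]).
      apply (same_surface_pos_eq _ (fun t u => plus (alpha t) (scal u (beta t)))).
      * intros t u [ht _]. now apply e.
      * exact hs.
    + intro h. destruct (helicoid_piece_ruled S h) as (I & J & alpha & beta & hr & _ & _ & hp).
      now exists I, J, alpha, beta.
  - intro h. destruct (helicoid_piece_ruled S h) as (I & J & alpha & beta & hr & hd & hR & _).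
    assert (hr' := hr). destruct hr' as (hI & hJ & ha & hb & hc & hP & hs).
    split; [split|].
    + now exists I, J, alpha, beta.
    + exact (same_surface_ricci _ _ hP hS (same_surface_sym _ _ hs) hR).
    + exists I, J, alpha, beta, (distribution alpha beta).
      split; [exact hr|]. split; [now apply (ruled_distribution_parameter S I J)|].
      intro hz. destruct (open_interval_inhabited I hI) as [t ht].
      exact (hd t ht (hz t ht)).
Qed.
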